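(* Let $P$ be a probability measure on $\Omega=\{0,1\}^{\mathbb{N}}$ and $\omega\in\Omega$. Then $\omega$ is blindly (oracle-free) random with respect to $P$ if and only if $\omega$ is random with respect to every effectively compact class of measures containing $P$.
   Context: A function $t:\Omega\to[0,\infty]$ is lower semicomputable if each $\{\omega:r<t(\omega)\}$ ($r$ rational) is a union of an enumerable (without oracle) family of intervals $x\Omega$, uniformly in $r$. A blind test for $P$ is a lower semicomputable $t$ with $\int t\,dP\le1$; $\omega$ is blindly random w.r.t. $P$ if $t(\omega)<\infty$ for every blind test $t$ for $P$. $\mathcal{M}(\Omega)$ is the space of probability measures with basic sets given by finitely many conditions $u<Q(y)<v$ ($u,v$ rational, $Q(y)=Q(y\Omega)$). A class $\mathcal{C}\subseteq\mathcal{M}(\Omega)$ is effectively compact if it is compact and the set of finite families of basic sets covering it is enumerable. A $\mathcal{C}$-test is a lower semicomputable $t\ge0$ with $\int t\,dQ\le1$ for all $Q\in\mathcal{C}$; $\omega$ is random w.r.t. $\mathcal{C}$ if $t(\omega)<\infty$ for every $\mathcal{C}$-test $t$ (equivalently, a universal $\mathcal{C}$-test is finite at $\omega$). *)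

(* Defs.v *)
From HB Require Import structures.
From mathcomp Require Import all_boot all_order all_algebra.
From mathcomp Require Import all_classical all_reals all_analysis.

Set Implicit Arguments.
Unset Strict Implicit.
Unset Printing Implicit Defensive.

Import Order.TTheory GRing.Theory Num.Theory.

Local Open Scope classical_set_scope.
Local Open Scope ring_scope.

(* Kleene's partial recursive functions. *)
Inductive recfun : nat -> Type :=
| RZero (n : nat) : recfun n
| RSucc : recfun 1
| RProj (n : nat) (i : 'I_n) : recfun n
| RComp (k n : nat) (f : recfun k) (g : 'I_k -> recfun n) : recfun n
| RPrec (n : nat) (f : recfun n) (g : recfun n.+2) : recfun n.+1
| RMu (n : nat) (f : recfun n.+1) : recfun n.

(* [rec_eval f v y]: f is defined at v, with value y. In [RPrec], h 0, ...,   *)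
(* h (thead v) are the successive values of the recursion; in [RMu], f has to *)
(* be defined and nonzero at every z < y.                                     *)
Fixpoint rec_eval (n : nat) (f : recfun n) : n.-tuple nat -> nat -> Prop :=
  match f in recfun n return n.-tuple nat -> nat -> Prop with
  | RZero _ => fun _ y => y = 0%N
  | RSucc => fun v y => y = (thead v).+1
  | RProj _ i => fun v y => y = tnth v i
  | RComp k _ f g => fun v y =>
      exists2 w : k.-tuple nat,
        (forall i, rec_eval (g i) v (tnth w i)) & rec_eval f w y
  | RPrec _ f g => fun v y =>
      exists h : nat -> nat,
        [/\ rec_eval f [tuple of behead v] (h 0%N),
            forall i, (i < thead v)%N ->
              rec_eval g [tuple of i :: h i :: behead v] (h i.+1)
          & y = h (thead v)]
  | RMu _ f => fun v y =>
      rec_eval f [tuple of y :: v] 0%N /\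
      forall z, (z < y)%N -> exists m, rec_eval f [tuple of z :: v] m.+1
  end.

(* Enumerable sets of finite objects: the codes of the elements of A form the *)
(* range of a partial recursive function. For an abstract countType [pickle]  *)
(* could be any injection; this is used only for types built from bool and    *)
(* rat by products and seq, on which [pickle] is the explicit primitive       *)
(* recursive coding displayed by the [pickle_*E] lemmas.                      *)
Definition enumerable (T : countType) (A : set T) : Prop :=
  exists f : recfun 1,
    [set y | exists n, rec_eval f [tuple n] y] = [set pickle x | x in A].

Lemma pickle_boolE (b : bool) : pickle b = b.
Proof. by []. Qed.

Lemma pickle_seqE (T : countType) (s : seq T) :
  pickle s = CodeSeq.code [seq pickle x | x <- s].
Proof. by []. Qed.

Lemma pickle_pairE (T1 T2 : countType) (x : T1) (y : T2) :
  pickle (x, y) = CodeSeq.code [:: pickle x; pickle y].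
Proof. by []. Qed.

Lemma pickle_PoszE (n : nat) :
  pickle (Posz n) = CodeSeq.code [:: CodeSeq.code [:: n]; CodeSeq.code [::]].
Proof. by []. Qed.

Lemma pickle_NegzE (n : nat) :
  pickle (Negz n) = CodeSeq.code [:: CodeSeq.code [::]; CodeSeq.code [:: n]].
Proof. by []. Qed.

Lemma pickle_ratE (q : rat) :
  pickle q = CodeSeq.code [:: pickle (numq q); pickle (denq q)].
Proof. by []. Qed.

Definition cylinder (x : seq bool) : set (nat -> bool) :=
  [set w | forall i, (i < size x)%N -> w i = nth false x i].

Definition Omega := g_sigma_algebraType (range cylinder).
HB.instance Definition _ := Measurable.on Omega.

(* The library's measures are functions on all sets: two elements that agree  *)
(* on measurable sets may be distinct, but are topologically                  *)
(* indistinguishable and integrate lower semicomputable functions alike.      *)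
Definition measures (R : realType) := probability Omega R.
HB.instance Definition _ (R : realType) := Choice.on (measures R).

(* (y, u, v) stands for the condition u < Q(y Omega) < v. *)
Notation condition := (seq bool * rat * rat)%type.

Definition satisfies (R : realType) (c : condition) : set (measures R) :=
  [set Q | let: (y, u, v) := c in
    ((ratr u)%:E < Q (cylinder y))%E /\ (Q (cylinder y) < (ratr v)%:E)%E].

Definition basic (R : realType) (b : seq condition) : set (measures R) :=
  [set Q | forall c, c \in b -> satisfies c Q].

(* The index type of a base has to be pointed. *)
HB.instance Definition _ (T : choiceType) := isPointed.Build (seq T) [::].

Section measures_topology.
Context (R : realType).

Let basic_cover : \bigcup_(b in [set: seq condition]) @basic R b = setT.
Proof. by apply/seteqP; split => // Q _; exists [::]. Qed.

Let basic_join (b1 b2 : seq condition) (Q : measures R) :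
  setT b1 -> setT b2 -> basic b1 Q -> basic b2 Q ->
  exists b, [/\ setT b, basic b Q & @basic R b `<=` basic b1 `&` basic b2].
Proof.
move=> _ _ Q1 Q2; exists (b1 ++ b2); split => //.
  by move=> c; rewrite mem_cat => /orP[/Q1|/Q2].
by move=> Q' bQ'; split=> c cb; apply: bQ'; rewrite mem_cat cb ?orbT.
Qed.

HB.instance Definition _ :=
  isBaseTopological.Build (measures R) basic_cover basic_join.

End measures_topology.

Definition lower_semicomputable (R : realType) (t : Omega -> \bar R) : Prop :=
  (forall w, (0 <= t w)%E) /\
  exists2 W : set (rat * seq bool), enumerable W &
    forall r : rat, [set w | ((ratr r)%:E < t w)%E] =
      \bigcup_(x in [set x | W (r, x)]) cylinder x.

Definition blind_test (R : realType) (P : measures R) (t : Omega -> \bar R)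
    : Prop :=
  lower_semicomputable t /\ (\int[P]_w t w <= 1)%E.

Definition blindly_random (R : realType) (P : measures R) (w : Omega) : Prop :=
  forall t, blind_test P t -> (t w < +oo)%E.

Definition covers (R : realType) (C : set (measures R))
    (F : seq (seq condition)) : Prop :=
  C `<=` \bigcup_(b in [set` F]) @basic R b.

Definition effectively_compact (R : realType) (C : set (measures R)) : Prop :=
  compact C /\ enumerable [set F | covers C F].

Definition class_test (R : realType) (C : set (measures R))
    (t : Omega -> \bar R) : Prop :=
  lower_semicomputable t /\ forall Q, C Q -> (\int[Q]_w t w <= 1)%E.

Definition class_random (R : realType) (C : set (measures R)) (w : Omega)
    : Prop :=
  forall t, class_test C t -> (t w < +oo)%E.

(* Main.v *)
Require Import Defs.
From HB Require Import structures.
From mathcomp Require Import all_boot all_order all_algebra.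
From mathcomp Require Import all_classical all_reals all_analysis.
From mathcomp Require Import measurable_realfun zify lra.

Set Implicit Arguments.
Unset Strict Implicit.
Unset Printing Implicit Defensive.

Import Order.TTheory GRing.Theory Num.Theory.
Import numFieldNormedType.Exports.

(* A class test is a blind test, so only one implication has content. Given a *)
(* blind test t for P, the class C of all Q with \int t dQ <= 1 contains P    *)
(* and has t as a class test, so it suffices that C is effectively compact.   *)
(* Compactness: along an ultrafilter of measures the values on cylinders      *)
(* converge, and the limits are the cylinder values of a measure, realised as *)
(* the image of Lebesgue measure on [0, 1[ under the map that reads off the   *)
(* bits of a point from nested intervals of the prescribed lengths.           *)
(* Enumerability of the covers: let K = 4^N + 2^N. A finite family F covers C *)
(* if and only if, for some N, every list L of 4^N words of length N either   *)
(* has (sum over L of the N-th approximation of t) > K, or satisfies all the  *)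
(* conditions u < Q(y) < v of some b in F in the discretised form             *)
(* u K < n < v K - 2^N, where n is the number of words of L extending y.      *)
(* If so, round K Q down on the cylinders of length N: this gives a list L    *)
(* that describes Q up to the error 2^N. If not, the frequencies of the       *)
(* failing lists L_N converge along a nonprincipal ultrafilter to a Q in C    *)
(* that F does not cover.                                                     *)

Local Open Scope nat_scope.

(** * Total recursive functions *)


(** One direction is formal: a test for a class containing $P$ is a blind test for $P$. For the
    other, a blind test $t$ yields the class $C$ of all $Q$ with $\int t\,dQ\le 1$, which contains
    $P$ and has $t$ among its tests; everything rests on [effectively_compact_integral_le1].

    The lower approximations of $t$ are step functions on cylinders, so by monotone convergence
    ([integral_le1P]) membership in $C$ amounts to countably many non-strict linear inequalities,
    each in finitely many cylinder values. Such inequalities survive limits along ultrafilters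
    ([exists_limit_measure]), which gives compactness ([compact_integral_le1]).

    The same limit argument makes covering semidecidable. At stage $N$ only finitely many samples
    exist, namely the lists of $4^N$ words of length $N$, and [cover_stage] inspects all of them. A
    successful stage is sound because every $Q$ in $C$ is approximated by a sample that passes the
    test on $t$ ([cover_stage_basic]). Some stage succeeds for each cover because failing samples
    would accumulate at a measure of $C$ outside the cover ([covers_stage]).

    The enumeration itself is obtained from two facts: a partial recursive function run with bounded
    fuel is total recursive ([crec_evalf]), so an enumerable set is the union of computable finite
    stages ([enumerable_stages]), and conversely a search over decidable stages enumerates a set
    ([enumerable_of_stages]). *)

Definition crec n (f : n.-tuple nat -> nat) : Prop :=
  exists e : recfun n, forall v, rec_eval e v (f v).

Lemma eq_crec n (f g : n.-tuple nat -> nat) : f =1 g -> crec f -> crec g.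
Proof. by move=> fg [e He]; exists e => v; rewrite -fg. Qed.

Lemma crec_comp k n (f : k.-tuple nat -> nat) (g : 'I_k -> n.-tuple nat -> nat) :
  crec f -> (forall i, crec (g i)) -> crec (fun v => f [tuple g i v | i < k]).
Proof.
move=> [e He] /choice[e' He'].
exists (RComp e e') => v; exists [tuple g i v | i < k] => // i.
by rewrite tnth_mktuple.
Qed.

Lemma crec_proj n (i : 'I_n) : crec (fun v => tnth v i).
Proof. by exists (RProj i). Qed.

Definition crec1 (g : nat -> nat) := crec (fun v : 1.-tuple nat => g (thead v)).
Definition crec2 (g : nat -> nat -> nat) :=
  crec (fun v : 2.-tuple nat => g (tnth v ord0) (tnth v ord_max)).

Lemma crec1_comp n g (f : n.-tuple nat -> nat) :
  crec1 g -> crec f -> crec (fun v => g (f v)).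
Proof.
move=> cg cf; apply: (@eq_crec _ (fun v => g (thead [tuple f v | _ < 1]))).
  by move=> v; rewrite /thead tnth_mktuple.
exact: (crec_comp (g := fun=> f) cg).
Qed.

Lemma crec2_comp n g (f1 f2 : n.-tuple nat -> nat) :
  crec2 g -> crec f1 -> crec f2 -> crec (fun v => g (f1 v) (f2 v)).
Proof.
move=> cg c1 c2.
pose F (i : 'I_2) v := if i == ord0 then f1 v else f2 v.
have cF i : crec (F i) by rewrite /F; case: eqP.
apply: eq_crec (crec_comp cg cF) => v.
by rewrite !tnth_mktuple.
Qed.

Lemma crec_const n c : crec (fun _ : n.-tuple nat => c).
Proof.
elim: c => [|c IH]; first by exists (RZero n).
apply: (crec1_comp _ IH); by exists RSucc.
Qed.

Lemma crec_natrec n (z m : n.-tuple nat -> nat) (s : nat -> nat -> n.-tuple nat -> nat) :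
  crec z -> crec m ->
  crec (fun u : n.+2.-tuple nat =>
     s (tnth u ord0) (tnth u (lift ord0 ord0)) [tuple of behead (behead u)]) ->
  crec (fun v => nat_rect _ (z v) (fun i h => s i h v) (m v)).
Proof.
move=> [ez Hz] cm [es Hs].
have cp : crec (fun u : n.+1.-tuple nat =>
  nat_rect _ (z [tuple of behead u]) (fun i h => s i h [tuple of behead u]) (thead u)).
  exists (RPrec ez es) => u.
  exists (fun i => nat_rect _ (z [tuple of behead u])
     (fun i h => s i h [tuple of behead u]) i); split => // i _.
  have := Hs [tuple of i :: nat_rect _ (z [tuple of behead u])
     (fun i h => s i h [tuple of behead u]) i :: behead u].
  rewrite (tnth_nth 0) (tnth_nth 0) /=.
  congr (rec_eval _ _ _); congr (s _ _ _); exact: val_inj.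
(* [RPrec] recurses on its first argument, so [G] puts the bound [m v] in front of the parameters
   [v]. *)
pose G (i : 'I_n.+1) (v : n.-tuple nat) :=
  if unlift ord0 i is Some j then tnth v j else m v.
have cG i : crec (G i).
  by rewrite /G; case: unlift => // j; exact: crec_proj.
apply: eq_crec (crec_comp cp cG) => v.
have -> : [tuple of behead [tuple G i v | i < n.+1]] = v.
  apply: eq_from_tnth => i; rewrite tnth_behead tnth_mktuple /G.
  have -> : inord i.+1 = lift ord0 i :> 'I_n.+1.
    by apply: val_inj; rewrite /= inordK //= ltnS.
  by rewrite liftK.
by rewrite /thead tnth_mktuple /G unlift_none.
Qed.

Lemma crec_weak2 n (f : n.-tuple nat -> nat) :
  crec f -> crec (fun u : n.+2.-tuple nat => f [tuple of behead (behead u)]).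
Proof.
move=> cf.
apply: eq_crec (crec_comp cf (fun i : 'I_n => @crec_proj n.+2 (inord i.+2))) => u.
congr f; apply: eq_from_tnth => i; rewrite tnth_mktuple !(tnth_nth 0) /=.
by rewrite !nth_behead inordK // !ltnS.
Qed.

Lemma crec1I g : (forall n (f : n.-tuple nat -> nat), crec f -> crec (fun v => g (f v))) ->
  crec1 g.
Proof. by move=> H; apply: H; exact: crec_proj. Qed.

Lemma crec2I g : (forall n (f1 f2 : n.-tuple nat -> nat), crec f1 -> crec f2 ->
   crec (fun v => g (f1 v) (f2 v))) -> crec2 g.
Proof. by move=> H; apply: H; exact: crec_proj. Qed.

Lemma crecS n (f : n.-tuple nat -> nat) : crec f -> crec (fun v => (f v).+1).
Proof. by apply: crec1_comp; exists RSucc. Qed.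

Lemma crec_pred n (f : n.-tuple nat -> nat) : crec f -> crec (fun v => (f v).-1).
Proof.
move=> cf.
apply: (@eq_crec _ (fun v => nat_rect _ 0 (fun i h => i) (f v))).
  by move=> v; case: (f v).
apply: (crec_natrec (s := fun i h v => i) _ cf); first exact: crec_const.
exact: crec_proj.
Qed.

Lemma crec_if n (b f g : n.-tuple nat -> nat) : crec b -> crec f -> crec g ->
  crec (fun v => if b v is 0 then f v else g v).
Proof.
move=> cb cf cg.
apply: (@eq_crec _ (fun v => nat_rect _ (f v) (fun i h => g v) (b v))).
  by move=> v; case: (b v).
apply: (crec_natrec (s := fun i h v => g v)) => //; exact: crec_weak2.
Qed.

Lemma crec_add n (f g : n.-tuple nat -> nat) : crec f -> crec g ->
  crec (fun v => f v + g v).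
Proof.
move=> cf cg.
apply: (@eq_crec _ (fun v => nat_rect _ (f v) (fun i h => h.+1) (g v))).
  by move=> v; elim: (g v) => [|k IH] /=; rewrite ?addn0 ?addnS ?IH.
apply: (crec_natrec (s := fun i h v => h.+1)) => //; apply: crecS; exact: crec_proj.
Qed.

Lemma crec_sub n (f g : n.-tuple nat -> nat) : crec f -> crec g ->
  crec (fun v => f v - g v).
Proof.
move=> cf cg.
apply: (@eq_crec _ (fun v => nat_rect _ (f v) (fun i h => h.-1) (g v))).
  by move=> v; elim: (g v) => [|k IH] /=; rewrite ?subn0 ?subnS ?IH.
apply: (crec_natrec (s := fun i h v => h.-1)) => //; apply: crec_pred; exact: crec_proj.
Qed.

Lemma crec_mul n (f g : n.-tuple nat -> nat) : crec f -> crec g ->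
  crec (fun v => f v * g v).
Proof.
move=> cf cg.
apply: (@eq_crec _ (fun v => nat_rect _ 0 (fun i h => h + f v) (g v))).
  by move=> v; elim: (g v) => [|k IH] /=; rewrite ?muln0 // mulnSr IH.
apply: (crec_natrec (s := fun i h v => h + f v)) => //; first exact: crec_const.
by apply: crec_add; [exact: crec_proj | exact: crec_weak2].
Qed.

(* Evaluation with fuel s: the value 0 means that no result has been found    *)
(* yet, and k.+1 that the result is k. In the search for [RMu], the state is  *)
(* 0 while searching, 1 after hitting an undefined value, and z.+2 once z has *)
(* been found.                                                                *)
Fixpoint evalf n (f : recfun n) (s : nat) : n.-tuple nat -> nat :=
  match f in recfun n return n.-tuple nat -> nat with
  | RZero _ => fun _ => 1
  | RSucc => fun v => (thead v).+2
  | RProj _ i => fun v => (tnth v i).+1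
  | RComp k _ f g => fun v =>
      if [forall i, 0 < evalf (g i) s v] then
        evalf f s [tuple (evalf (g i) s v).-1 | i < k] else 0
  | RPrec _ f g => fun v =>
      nat_rect _ (evalf f s [tuple of behead v])
        (fun i h => if h is h'.+1 then evalf g s [tuple of i :: h' :: behead v] else 0)
        (thead v)
  | RMu _ f => fun v =>
      (nat_rect _ 0 (fun z st => if st is 0 then
          match evalf f s [tuple of z :: v] with
          | 0 => 1 | 1 => z.+2 | _ => 0 end else st) s).-1
  end.

Section search.
Variable ev : nat -> nat.
Let st := nat_rect _ 0 (fun z st => if st is 0 then
          match ev z with 0 => 1 | 1 => z.+2 | _ => 0 end else st).

(** [1 < ev z] means defined with a nonzero value, the only outcome after which the search goes
    on. *)
Lemma search0 n : (st n == 0) = [forall z : 'I_n, 1 < ev z].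
Proof.
elim: n => [|n IH]; first by symmetry; apply/forallP => -[].
have E : [forall z : 'I_n.+1, 1 < ev z] = [forall z : 'I_n, 1 < ev z] && (1 < ev n).
  apply/forallP/andP => [H|[/forallP H H'] z].
    split; last exact: (H ord_max).
    by apply/forallP => z; exact: (H (widen_ord (leqnSn n) z)).
  have [zn|] := ltnP z n; first exact: (H (Ordinal zn)).
  by move=> nz; have -> : z = n :> nat by move: (ltn_ord z); lia.
rewrite E -IH /=; case: (st n) => //=; by case: (ev n) => [|[|]].
Qed.

(** The outer predecessor merges the states 0 (searching) and 1 (blocked by an undefined value) into
    the answer that nothing has been found. *)
Lemma searchP n y : (st n).-1 = y.+1 <->
  [/\ y < n, ev y = 1 & forall z, z < y -> 1 < ev z].
Proof.
have H0 m : st m = 0 -> forall z, z < m -> 1 < ev z.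
  by move/eqP; rewrite search0 => /forallP H z zm; exact: (H (Ordinal zm)).
split.
  elim: n => //= n IH; case E: (st n) => [|k] /=.
    case En: (ev n) => [|[|]] //= [<-]; split=> //; exact: H0.
  move=> kE; have [] := IH _; first by rewrite E.
  by move=> yn ? ?; split=> //; exact: ltnW.
move=> [yn ey Hz].
elim: n yn => // n IH; rewrite ltnS leq_eqVlt => /predU1P[<-|/IH] /=.
  have /eqP -> : st y == 0.
    by rewrite search0; apply/forallP => z; exact: Hz.
  by rewrite ey.
by case: (st n).
Qed.
End search.

(** More fuel only turns undefined subresults into defined ones; a computation that has produced a
    result met no undefined subresult, so it is repeated unchanged. *)
Lemma evalf_mono n (f : recfun n) s s' v y : s <= s' ->
  evalf f s v = y.+1 -> evalf f s' v = y.+1.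
Proof.
move=> ss'; elim: f v y => //= {n}.
- move=> k n f IHf g IHg v y; case: ifPn => // /forallP Hi E.
  have Hg i : evalf (g i) s' v = evalf (g i) s v.
    by have := Hi i; case Ei: (evalf (g i) s v) => // _; exact: IHg.
  case: ifPn => [_|/negP[]]; last by apply/forallP => i; rewrite Hg.
  rewrite -(IHf _ _ E); congr evalf; apply: eq_from_tnth => i.
  by rewrite !tnth_mktuple Hg.
- move=> n f IHf g IHg v; elim: (thead v) => [|i IH] y /=; first exact: IHf.
  case E: (nat_rect _ _ _ _) => [|h] // H.
  by rewrite (IH _ E); exact: IHg.
- move=> n f IH v y /(searchP (fun z => evalf f s [tuple of z :: v])) [ys ey Hz].
  apply/(searchP (fun z => evalf f s' [tuple of z :: v])); split.
  + exact: leq_trans ss'.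
  + exact: IH.
  + move=> z /Hz; case Ez : (evalf f s _) => [|[|k]] // _.
    by rewrite (IH _ _ Ez).
Qed.

(** A terminating computation uses finitely many subcomputations; by [evalf_mono] the maximum of
    their fuels serves for all of them at once. *)
Lemma evalfP n (f : recfun n) v y :
  rec_eval f v y <-> exists s, evalf f s v = y.+1.
Proof.
elim: f v y => /= {n}.
- by move=> n v y; split=> [->|[s [->]]] //; exists 0.
- by move=> v y; split=> [->|[s [->]]] //; exists 0.
- by move=> n i v y; split=> [->|[s [->]]] //; exists 0.
- move=> k n f IHf g IHg v y; split.
    move=> [w Hw /IHf[s Hs]].
    have /choice[S HS] : forall i, exists s, evalf (g i) s v = (tnth w i).+1.
      by move=> i; apply/IHg.
    pose m := maxn s (\max_i S i).
    have Hg i : evalf (g i) m v = (tnth w i).+1.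
      apply: evalf_mono (HS i).
      by rewrite leq_max; apply/orP; right; exact: leq_bigmax.
    exists m; case: ifPn => [_|/negP[]]; last by apply/forallP => i; rewrite Hg.
    have -> : [tuple (evalf (g i) m v).-1 | i < k] = w.
      by apply: eq_from_tnth => i; rewrite tnth_mktuple Hg.
    by apply: evalf_mono Hs; rewrite leq_maxl.
  move=> [s]; case: ifPn => // /forallP Hi E.
  exists [tuple (evalf (g i) s v).-1 | i < k]; last by apply/IHf; exists s.
  move=> i; rewrite tnth_mktuple; apply/IHg; exists s.
  by rewrite prednK.
- move=> n f IHf g IHg v y; split.
    move=> [h [/IHf[s0 Hs0] Hh ->]].
    suff : forall k, k <= thead v -> exists s, nat_rect _ (evalf f s [tuple of behead v])
        (fun i h => if h is h'.+1 then evalf g s [tuple of i :: h' :: behead v] else 0)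
        k = (h k).+1 by apply.
    elim=> [|k IH] kv; first by exists s0.
    have [s1 E1] := IH (ltnW kv).
    have /IHg[s2 E2] := Hh k kv.
    exists (maxn s1 s2) => /=.
    suff -> : nat_rect _ (evalf f (maxn s1 s2) [tuple of behead v])
        (fun i h => if h is h'.+1 then evalf g (maxn s1 s2) [tuple of i :: h' :: behead v]
         else 0) k = (h k).+1 by apply: evalf_mono E2; exact: leq_maxr.
    elim: (k) (h k) E1 => [|i IHi] m /=.
      by apply: evalf_mono; exact: leq_maxl.
    case E: (nat_rect _ _ _ _) => [|c] // H.
    by rewrite (IHi _ E); apply: evalf_mono H; exact: leq_maxl.
  move=> [s].
  pose H := nat_rect _ (evalf f s [tuple of behead v])
        (fun i h => if h is h'.+1 then evalf g s [tuple of i :: h' :: behead v] else 0).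
  rewrite -/(H (thead v)) => E.
  (* Once the bounded recursion hits 0 (undefined) it stays 0; since its last value is positive, so
     are all earlier ones. *)
  have Hpos : forall k, k <= thead v -> 0 < H k.
    move=> k kv; rewrite lt0n; apply/negP => /eqP H0.
    suff : forall j, H (k + j) = 0.
      by move/(_ (thead v - k)); rewrite subnKC // E.
    by elim=> [|j IH]; rewrite ?addn0 // addnS /= -/(H _) IH.
  exists (fun i => (H i).-1); split.
  + by apply/IHf; exists s; have := Hpos 0 (leq0n _); rewrite /=; case: evalf.
  + move=> i iv; apply/IHg; exists s.
    have := Hpos i.+1 iv; have := Hpos i (ltnW iv); rewrite /= -/(H i).
    by case: (H i) => // h _; case: evalf.
  + by rewrite E.
- move=> n f IH v y; split.
    move=> [/IH[s0 H0] Hz].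
    have /choice[S HS] : forall z, exists s, z < y -> 1 < evalf f s [tuple of z :: v].
      move=> z; have [zy|] := ltnP z y; last by exists 0.
      by have [m /IH[s Hs]] := Hz z zy; exists s; rewrite Hs.
    pose s := maxn y.+1 (maxn s0 (\max_(z < y) S z)).
    exists s; apply/(searchP (fun z => evalf f s [tuple of z :: v])); split.
    + by rewrite leq_max leqnn.
    + by apply: evalf_mono H0; rewrite /s; lia.
    + move=> z zy; have := HS z zy; case E: evalf => [|[|m]] // _.
      rewrite (@evalf_mono _ f (S z) s _ _ _ E) //.
      have := @leq_bigmax _ (fun z : 'I_y => S z) (Ordinal zy); rewrite /s /=; lia.
  move=> [s /(searchP (fun z => evalf f s [tuple of z :: v])) [ys ey Hz]].
  split; first by apply/IH; exists s.
  move=> z /Hz; case E: evalf => [|[|m]] // _; exists m; apply/IH; by exists s.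
Qed.

Lemma rec_eval_fun n (f : recfun n) v y y' :
  rec_eval f v y -> rec_eval f v y' -> y = y'.
Proof.
move=> /evalfP[s Hs] /evalfP[s' Hs'].
have := evalf_mono (leq_maxl s s') Hs.
by rewrite (evalf_mono (leq_maxr s s') Hs') => -[].
Qed.

Definition fcons (A : Type) n (f : A -> nat) (g : 'I_n -> A -> nat) (j : 'I_n.+1) :
    A -> nat :=
  if unlift ord0 j is Some i then g i else f.

Lemma fconsE (A : Type) n (f : A -> nat) (g : 'I_n -> A -> nat) a :
  [tuple fcons f g j a | j < n.+1] = [tuple of f a :: [tuple g i a | i < n]].
Proof.
apply: eq_from_tnth => j; rewrite tnth_mktuple /fcons.
by case: unliftP => [i ->|->]; rewrite ?tnthS ?tnth0 ?tnth_mktuple.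
Qed.

Lemma behead_mktuple n (g : 'I_n.+1 -> nat) :
  [tuple of behead [tuple g i | i < n.+1]] = [tuple g (lift ord0 i) | i < n].
Proof.
apply: eq_from_tnth => i; rewrite tnth_behead !tnth_mktuple; congr g.
by apply: val_inj; rewrite /= inordK // ltnS.
Qed.

Lemma crec_fcons m n (f : m.-tuple nat -> nat) (g : 'I_n -> m.-tuple nat -> nat) j :
  crec f -> (forall i, crec (g i)) -> crec (fcons f g j).
Proof. by move=> cf cg; rewrite /fcons; case: unlift. Qed.

Lemma crec_prod n k (F : 'I_k -> n.-tuple nat -> nat) :
  (forall i, crec (F i)) -> crec (fun v => \prod_(i < k) F i v).
Proof.
elim: k F => [|k IH] F cF.
  by apply: eq_crec (crec_const n 1) => v; rewrite big_ord0.
apply: (@eq_crec _ (fun v => F ord0 v * \prod_(i < k) F (lift ord0 i) v)).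
  by move=> v; rewrite big_ord_recl.
by apply: crec_mul => //; exact: IH.
Qed.

(** For each fixed program [f], running it with bounded fuel is total recursive in the fuel and the
    arguments. Induction on [f] suffices, as no universal function is required. *)
Lemma crec_evalf n (f : recfun n) m (s : m.-tuple nat -> nat)
    (g : 'I_n -> m.-tuple nat -> nat) :
  crec s -> (forall i, crec (g i)) ->
  crec (fun v => evalf f (s v) [tuple g i v | i < n]).
Proof.
elim: f m s g => /= {n}.
- by move=> *; exact: crec_const.
- by move=> m s g cs cg; apply: eq_crec (crecS (crecS (cg ord0))) => v; rewrite /thead tnth_mktuple.
- by move=> n i m s g cs cg; apply: eq_crec (crecS (cg i)) => v; rewrite tnth_mktuple.
- move=> k n f IHf g IHg m s h cs ch.
  pose G i v := evalf (g i) (s v) [tuple h j v | j < n].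
  have cG i : crec (G i) by exact: IHg.
  (* The product vanishes exactly when some inner result is still undefined, which replaces the
     boolean quantifier by arithmetic. *)
  apply: (@eq_crec _ (fun v => if \prod_(i < k) G i v is 0 then 0 else
     evalf f (s v) [tuple (G i v).-1 | i < k])).
    move=> v; case: ifPn => [/forallP H|].
      suff : 0 < \prod_(i < k) G i v by case: (\prod_(i < k) _).
      by rewrite prodn_gt0.
    by rewrite negb_forall => /existsP[i]; rewrite -eqn0Ngt => /eqP Hi;
      rewrite (bigD1 i) //= /G Hi.
  apply: crec_if; [exact: crec_prod|exact: crec_const|].
  by apply: (IHf _ _ (fun i v => (G i v).-1)) => // i; exact: crec_pred.
- move=> n f IHf g IHg m s h cs ch.
  pose h' i := h (lift ord0 i).
  apply: (@eq_crec _ (fun v => nat_rect _ (evalf f (s v) [tuple h' i v | i < n])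
     (fun i k => if k is k'.+1 then evalf g (s v) [tuple of i :: k' :: [tuple h' i v | i < n]]
        else 0) (h ord0 v))).
    move=> v; rewrite behead_mktuple /thead tnth_mktuple.
    congr (nat_rect _ _ _ _); apply/funext => i; apply/funext => -[|k] //.
    congr evalf; apply: val_inj => /=; congr [:: _, _ & _].
    exact/esym/(congr1 val (behead_mktuple (fun i => h i v))).
  apply: (crec_natrec (s := fun i k v => if k is k'.+1 then evalf g (s v)
       [tuple of i :: k' :: [tuple h' i v | i < n]] else 0)).
  + by apply: IHf => // i; exact: ch.
  + exact: ch.
  (* [H] lists the arguments of [g]; the second is a predecessor because the recursion carries a
     result shifted by one. *)
  pose H := fcons (fun u : m.+2.-tuple nat => tnth u ord0)
    (fcons (fun u : m.+2.-tuple nat => (tnth u (lift ord0 ord0)).-1)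
      (fun i (u : m.+2.-tuple nat) => h' i [tuple of behead (behead u)])).
  apply: (@eq_crec _ (fun u => if tnth u (lift ord0 ord0) is 0 then 0 else
     evalf g (s [tuple of behead (behead u)]) [tuple H j u | j < n.+2])).
    move=> u; case E: (tnth u (lift ord0 ord0)) => [|k] //.
    congr evalf; rewrite !fconsE; apply: val_inj => /=.
    by rewrite E.
  apply: crec_if; [exact: crec_proj|exact: crec_const|].
  apply: IHg => [|j]; first exact: crec_weak2.
  apply: crec_fcons => [|i]; first exact: crec_proj.
  apply: crec_fcons => [|{}i]; first by apply: crec_pred; exact: crec_proj.
  by apply: crec_weak2; exact: ch.
- move=> n f IHf m s h cs ch; apply: crec_pred.
  apply: (crec_natrec (s := fun z st v => if st is 0 then
     match evalf f (s v) [tuple of z :: [tuple h i v | i < n]] with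
     | 0 => 1 | 1 => z.+2 | _ => 0 end else st)) => //; first exact: crec_const.
  pose H := fcons (fun u : m.+2.-tuple nat => tnth u ord0)
      (fun i (u : m.+2.-tuple nat) => h i [tuple of behead (behead u)]).
  pose e (u : m.+2.-tuple nat) := evalf f (s [tuple of behead (behead u)]) [tuple H j u | j < n.+1].
  have ce : crec e.
    apply: IHf => [|j]; first exact: crec_weak2.
    apply: crec_fcons => [|i]; first exact: crec_proj.
    by apply: crec_weak2; exact: ch.
  apply: (@eq_crec _ (fun u => if tnth u (lift ord0 ord0) is 0 then
     (if e u is 0 then 1 else if (e u).-1 is 0 then (tnth u ord0).+2 else 0) else
     tnth u (lift ord0 ord0))).
    move=> u; case E: (tnth u (lift ord0 ord0)) => [|k] //.
    by rewrite /e fconsE; case: evalf => [|[|]].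
  apply: crec_if; [exact: crec_proj| |exact: crec_proj].
  apply: crec_if => //; first exact: crec_const.
  apply: crec_if; [exact: crec_pred| |exact: crec_const].
  by do 2! apply: crecS; exact: crec_proj.
Qed.

(** * Arithmetic and the decoding of sequence codes *)

Lemma crec_exp2 n (f : n.-tuple nat -> nat) : crec f -> crec (fun v => 2 ^ f v).
Proof.
move=> cf.
apply: (@eq_crec _ (fun v => nat_rect _ 1 (fun i h => 2 * h) (f v))).
  by move=> v; elim: (f v) => [|k IH] //=; rewrite IH expnS.
apply: (crec_natrec (s := fun i h v => 2 * h)) => //; first exact: crec_const.
by apply: crec_mul; [exact: crec_const|exact: crec_proj].
Qed.

Lemma crec_leq n (f g : n.-tuple nat -> nat) : crec f -> crec g ->
  crec (fun v => (f v <= g v : nat)).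
Proof.
move=> cf cg; apply: (@eq_crec _ (fun v => 1 - (f v - g v))).
  by move=> v; case: leqP; lia.
by do !apply: crec_sub => //; exact: crec_const.
Qed.

Lemma crec_eqn n (f g : n.-tuple nat -> nat) : crec f -> crec g ->
  crec (fun v => (f v == g v : nat)).
Proof.
move=> cf cg; apply: (@eq_crec _ (fun v => (f v <= g v) * (g v <= f v))).
  by move=> v; rewrite eqn_leq mulnb.
by apply: crec_mul; exact: crec_leq.
Qed.

Lemma crec_ite n (b : n.-tuple nat -> bool) (f g : n.-tuple nat -> nat) :
  crec (fun v => b v : nat) -> crec f -> crec g -> crec (fun v => if b v then f v else g v).
Proof.
move=> cb cf cg; apply: eq_crec (crec_if cb cg cf) => v; by case: (b v).
Qed.

(** A counter grows as long as its successor still fits: after $k$ rounds it equals the minimum of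
    $k$ and the quotient, so [f v] rounds suffice. [crec_log2] uses the same loop. *)
Lemma crec_div n (f g : n.-tuple nat -> nat) : crec f -> crec g ->
  (forall v, 0 < g v) -> crec (fun v => f v %/ g v).
Proof.
move=> cf cg g0.
apply: (@eq_crec _ (fun v => nat_rect _ 0
    (fun i h => if h.+1 * g v <= f v then h.+1 else h) (f v))).
  move=> v.
  suff -> : forall k, nat_rect (fun=> nat) 0
    (fun i h => if h.+1 * g v <= f v then h.+1 else h) k = minn k (f v %/ g v).
    by apply/minn_idPr; exact: leq_div.
  elim=> [|k IH]; first by rewrite min0n.
  rewrite /= IH -leq_divRL //; case: ifPn; lia.
apply: (crec_natrec (s := fun i h v => if h.+1 * g v <= f v then h.+1 else h)) => //.
  exact: crec_const.
have cp : crec (fun u : n.+2.-tuple nat => tnth u (lift ord0 ord0)) by exact: crec_proj.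
apply: crec_ite => //; last exact: crecS.
apply: crec_leq; last exact: crec_weak2.
by apply: crec_mul; [exact: crecS|exact: crec_weak2].
Qed.

Lemma crec_dvd n (f g : n.-tuple nat -> nat) : crec f -> crec g ->
  (forall v, 0 < g v) -> crec (fun v => (g v %| f v : nat)).
Proof.
move=> cf cg g0; apply: (@eq_crec _ (fun v => (f v %/ g v * g v == f v : nat))).
  by move=> v; rewrite dvdn_eq.
by apply: crec_eqn => //; apply: crec_mul => //; exact: crec_div.
Qed.

Lemma crec_log2 n (f : n.-tuple nat -> nat) : crec f -> crec (fun v => logn 2 (f v)).
Proof.
move=> cf.
apply: (@eq_crec _ (fun v => nat_rect _ 0
    (fun i h => if 2 ^ h.+1 %| f v then h.+1 else h) (f v))).
  move=> v; case: (posnP (f v)) => [->//|f0].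
  suff -> : forall k, nat_rect (fun=> nat) 0
    (fun i h => if 2 ^ h.+1 %| f v then h.+1 else h) k = minn k (logn 2 (f v)).
    apply/minn_idPr; rewrite -ltnS; apply: (@leq_trans (f v)); last exact: leqnSn.
    exact: ltn_logl.
  elim=> [|k IH]; first by rewrite min0n.
  rewrite /= IH pfactor_dvdn //; case: ifPn; lia.
apply: (crec_natrec (s := fun i h v => if 2 ^ h.+1 %| f v then h.+1 else h)) => //.
  exact: crec_const.
have cp : crec (fun u : n.+2.-tuple nat => tnth u (lift ord0 ord0)) by exact: crec_proj.
apply: crec_ite => //; last exact: crecS.
apply: crec_dvd => [| |v]; first exact: crec_weak2.
  by apply: crec_exp2; exact: crecS.
by rewrite expn_gt0.
Qed.

(** The code of $n::s$ is $2^n(2c+1)$ with $c$ the code of $s$: the 2-adic valuation is the head,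
    and dividing out the power of 2 and halving leaves the tail. *)
Definition code_tail c := (c %/ 2 ^ logn 2 c) %/ 2.

Lemma logn_code n s : logn 2 (CodeSeq.code (n :: s)) = n.
Proof.
rewrite /= lognM ?expn_gt0 // pfactorK // [logn 2 _.+1]lognE /= dvdn2 /= odd_double.
exact: addn0.
Qed.

Lemma code_tailE n s : code_tail (CodeSeq.code (n :: s)) = CodeSeq.code s.
Proof.
by rewrite /code_tail logn_code /= mulKn ?expn_gt0 // divn2 /= uphalf_double.
Qed.

Lemma crec_tail n (f : n.-tuple nat -> nat) : crec f -> crec (fun v => code_tail (f v)).
Proof.
move=> cf; apply: crec_div; [|exact: crec_const|by[]].
by apply: crec_div => [//||v]; [apply: crec_exp2; exact: crec_log2|rewrite expn_gt0].
Qed.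

(** This lets the code of a list serve as a bound on the number of rounds of a loop over the
    list. *)
Lemma size_code s : size s <= CodeSeq.code s.
Proof.
elim: s => //= n s IH; have : 0 < 2 ^ n by rewrite expn_gt0.
by move: IH; rewrite -muln2; nia.
Qed.

(** * Computability on coded countable types *)

(* The tracking function g is unconstrained on numbers that code nothing. *)
Definition tcomp (A B : countType) (f : A -> B) : Prop :=
  exists2 g, crec1 g & forall a, g (pickle a) = pickle (f a).

Section tcomp_basics.
Variables A B C : countType.
Implicit Types (f : A -> B).

Lemma eq_tcomp f f' : f =1 f' -> tcomp f -> tcomp f'.
Proof. by move=> ff' [g cg Hg]; exists g => // a; rewrite Hg ff'. Qed.

Lemma tcomp_id : tcomp (fun a : A => a).
Proof. by exists id => //; exact: crec_proj. Qed.

Lemma tcomp_comp (h : B -> C) f : tcomp h -> tcomp f -> tcomp (fun a => h (f a)).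
Proof.
move=> [g cg Hg] [g' cg' Hg']; exists (fun n => g (g' n)); first exact: (crec1_comp cg cg').
by move=> a; rewrite Hg' Hg.
Qed.

Lemma tcomp_const (b : B) : tcomp (fun _ : A => b).
Proof. by exists (fun=> pickle b) => //; exact: crec_const. Qed.

Lemma tcomp_pickle : tcomp (fun a : A => pickle a).
Proof. by exists id => //; exact: crec_proj. Qed.

Lemma crec_pair n (u v : n.-tuple nat -> nat) : crec u -> crec v ->
  crec (fun w => CodeSeq.code [:: u w; v w]).
Proof.
move=> cu cv; apply: crec_mul; first exact: crec_exp2.
apply: crecS; apply: (@eq_crec _ (fun w => 2 * (2 ^ v w * 1))).
  by move=> w; rewrite mul2n.
apply: crec_mul; first exact: crec_const.
by apply: crec_mul; [exact: crec_exp2|exact: crec_const].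
Qed.

Lemma tcomp_pair f (h : A -> C) : tcomp f -> tcomp h -> tcomp (fun a => (f a, h a)).
Proof.
move=> [g cg Hg] [g' cg' Hg']; exists (fun n => CodeSeq.code [:: g n; g' n]).
  exact: crec_pair.
by move=> a; rewrite Hg Hg'.
Qed.

Lemma tcomp_fst (h : C -> A * B) : tcomp h -> tcomp (fun c => (h c).1).
Proof.
move=> [g cg Hg]; exists (fun n => logn 2 (g n)); first exact: crec_log2.
by move=> c; rewrite Hg; case: (h c) => a b; rewrite pickle_pairE logn_code.
Qed.

Lemma tcomp_snd (h : C -> A * B) : tcomp h -> tcomp (fun c => (h c).2).
Proof.
move=> [g cg Hg]; exists (fun n => logn 2 (code_tail (g n))).
  by apply: crec_log2; exact: crec_tail.
by move=> c; rewrite Hg; case: (h c) => a b; rewrite pickle_pairE code_tailE logn_code.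
Qed.

Lemma tcomp_if (b : A -> bool) f f' : tcomp b -> tcomp f -> tcomp f' ->
  tcomp (fun a => if b a then f a else f' a).
Proof.
move=> [g cg Hg] [g1 cg1 Hg1] [g2 cg2 Hg2].
exists (fun n => if g n is 0 then g2 n else g1 n); first exact: (crec_if cg cg2 cg1).
by move=> a; rewrite Hg Hg1 Hg2; case: (b a).
Qed.

Lemma tcomp_eq f f' : tcomp f -> tcomp f' -> tcomp (fun a => f a == f' a).
Proof.
move=> [g1 cg1 Hg1] [g2 cg2 Hg2].
exists (fun n => (g1 n == g2 n : nat)); first exact: crec_eqn.
move=> a; rewrite Hg1 Hg2; congr nat_of_bool; apply/eqP/eqP => [|-> //].
exact: (pcan_inj pickleK).
Qed.

Lemma tcomp_cons f (s : A -> seq B) : tcomp f -> tcomp s -> tcomp (fun a => f a :: s a).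
Proof.
move=> [g cg Hg] [g' cg' Hg']; exists (fun n => 2 ^ g n * (2 * g' n).+1).
  apply: crec_mul; first exact: crec_exp2.
  by apply: crecS; apply: crec_mul => //; exact: crec_const.
by move=> a; rewrite Hg Hg' mul2n.
Qed.

End tcomp_basics.

Lemma tcomp_nat1 (A : countType) (g : nat -> nat) (f : A -> nat) :
  crec1 g -> tcomp f -> tcomp (fun a => g (f a)).
Proof. by move=> cg; apply: tcomp_comp; exists g. Qed.

Lemma tcomp_nat2 (A : countType) (g : nat -> nat -> nat) (f1 f2 : A -> nat) :
  crec2 g -> tcomp f1 -> tcomp f2 -> tcomp (fun a => g (f1 a) (f2 a)).
Proof.
move=> cg [g1 c1 H1] [g2 c2 H2]; exists (fun n => g (g1 n) (g2 n)).
  exact: (crec2_comp cg).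
by move=> a; rewrite H1 H2.
Qed.

Section tcomp_nat.
Variables (A : countType) (f g : A -> nat).
Hypotheses (cf : tcomp f) (cg : tcomp g).

Lemma tcompS : tcomp (fun a => (f a).+1).
Proof. by apply: tcomp_nat1 => //; apply: crec1I => n h; exact: crecS. Qed.

Lemma tcomp_pred : tcomp (fun a => (f a).-1).
Proof. by apply: tcomp_nat1 => //; apply: crec1I => n h; exact: crec_pred. Qed.

Lemma tcomp_exp2 : tcomp (fun a => 2 ^ f a).
Proof. by apply: (@tcomp_nat1 _ (expn 2)) => //; apply: crec1I => n h; exact: crec_exp2. Qed.

Lemma tcomp_add : tcomp (fun a => f a + g a).
Proof. by apply: tcomp_nat2 => //; apply: crec2I => n h h'; exact: crec_add. Qed.

Lemma tcomp_mul : tcomp (fun a => f a * g a).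
Proof. by apply: tcomp_nat2 => //; apply: crec2I => n h h'; exact: crec_mul. Qed.

Lemma tcomp_leq : tcomp (fun a => f a <= g a).
Proof.
have [g' cg' Hg'] : tcomp (fun a => (f a <= g a : nat)).
  apply: (@tcomp_nat2 _ (fun m n => (m <= n : nat))) => //.
  by apply: crec2I => n h h'; exact: crec_leq.
by exists g'.
Qed.

Lemma tcomp_max : tcomp (fun a => maxn (f a) (g a)).
Proof.
apply: (@tcomp_nat2 _ maxn) => //; apply: crec2I => n h h' ch ch'.
apply: (@eq_crec _ (fun v => h v + (h' v - h v))).
  by move=> v; rewrite maxnE.
by apply: crec_add => //; exact: crec_sub.
Qed.

Lemma tcomp_div : (forall a, 0 < g a) -> tcomp (fun a => f a %/ g a).
Proof.
move=> g0; apply: (@eq_tcomp _ _ (fun a => f a %/ (g a).-1.+1)).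
  by move=> a; rewrite prednK.
apply: (@tcomp_nat2 _ (fun m n => m %/ n.-1.+1)) => //.
apply: crec2I => n h h' ch ch'; apply: crec_div => //.
by apply: crecS; exact: crec_pred.
Qed.

End tcomp_nat.

Section tcomp_bool.
Variables (A : countType) (b c : A -> bool).
Hypotheses (cb : tcomp b) (cc : tcomp c).

Lemma tcomp_and : tcomp (fun a => b a && c a).
Proof.
apply: (@eq_tcomp _ _ (fun a => if b a then c a else false)).
  by move=> a; case: (b a).
by apply: tcomp_if => //; exact: tcomp_const.
Qed.

Lemma tcomp_or : tcomp (fun a => b a || c a).
Proof.
apply: (@eq_tcomp _ _ (fun a => if b a then true else c a)).
  by move=> a; case: (b a).
by apply: tcomp_if => //; exact: tcomp_const.
Qed.

End tcomp_bool.

Section tcomp_rec.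
Variables (A B C : countType).

Lemma tcomp_natrec (f : A -> nat -> C -> C) (z : A -> C) (n : A -> nat) :
  tcomp (fun x : A * nat * C => f x.1.1 x.1.2 x.2) -> tcomp z -> tcomp n ->
  tcomp (fun a => nat_rect (fun=> C) (z a) (f a) (n a)).
Proof.
move=> [F cF HF] [Z cZ HZ] [N cN HN].
pose p x y := CodeSeq.code [:: x; y].
exists (fun x => nat_rect (fun=> nat) (Z x) (fun i h => F (p (p x i) h)) (N x)).
  apply: (crec_natrec (s := fun i h v => F (p (p (thead v) i) h))) => //.
  apply: (crec1_comp cF); apply: crec_pair; last exact: crec_proj.
  apply: crec_pair; last exact: crec_proj.
  by apply: (crec_weak2 (f := fun v : 1.-tuple nat => thead v)); exact: crec_proj.
move=> a; rewrite HN; elim: (n a : nat) => [|k IH] /=; first exact: HZ.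
by rewrite IH -(HF (a, k, _)).
Qed.

Lemma iter_code_tail k s : iter k code_tail (CodeSeq.code s) = CodeSeq.code (drop k s).
Proof.
elim: k => [|k IH] /=; first by rewrite drop0.
rewrite IH; have [ks|sk] := ltnP k (size s); last by rewrite !drop_oversize // ltnW.
by rewrite (drop_nth 0 ks) code_tailE.
Qed.

Lemma crec_iter_tail n (f k : n.-tuple nat -> nat) : crec f -> crec k ->
  crec (fun v => iter (k v) code_tail (f v)).
Proof.
move=> cf ck; apply: (@eq_crec _ (fun v => nat_rect _ (f v) (fun i h => code_tail h) (k v))).
  by move=> v; elim: (k v) => //= m ->.
apply: (crec_natrec (s := fun i h v => code_tail h)) => //.
by apply: crec_tail; exact: crec_proj.
Qed.

Lemma tcomp_foldl (f : A -> C -> B -> C) (z : A -> C) (s : A -> seq B) :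
  tcomp (fun x : A * C * B => f x.1.1 x.1.2 x.2) -> tcomp z -> tcomp s ->
  tcomp (fun a => foldl (f a) (z a) (s a)).
Proof.
move=> [F cF HF] [Z cZ HZ] [S cS HS].
pose p x y := CodeSeq.code [:: x; y].
(* Round [i] reads the head after [i] tails. The code 0 is that of the empty list, so the rounds
   past the end leave the accumulator alone. *)
pose step i h x := if iter i code_tail (S x) is 0 then h
   else F (p (p x h) (logn 2 (iter i code_tail (S x)))).
exists (fun x => nat_rect (fun=> nat) (Z x) (fun i h => step i h x) (S x)).
  apply: (crec_natrec (s := fun i h v => step i h (thead v))) => //.
  have cx : crec (fun u : 3.-tuple nat => thead [tuple of behead (behead u)]).
    by apply: (crec_weak2 (f := fun v : 1.-tuple nat => thead v)); exact: crec_proj.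
  have ci : crec (fun u : 3.-tuple nat =>
      iter (tnth u ord0) code_tail (S (thead [tuple of behead (behead u)]))).
    by apply: crec_iter_tail; [exact: (crec1_comp cS)|exact: crec_proj].
  apply: crec_if => //; first exact: crec_proj.
  apply: (crec1_comp cF); apply: crec_pair; last exact: crec_log2.
  by apply: crec_pair => //; exact: crec_proj.
move=> a; rewrite HS.
suff H : forall k, nat_rect (fun=> nat) (Z (pickle a)) (fun i h => step i h (pickle a)) k =
   pickle (foldl (f a) (z a) (take k (s a))).
  rewrite H take_oversize // pickle_seqE.
  by apply: leq_trans (size_code _); rewrite size_map.
elim=> [|k /= ->]; first by rewrite take0 /= HZ.
rewrite /step HS pickle_seqE iter_code_tail -map_drop.
have [ks|sk] := ltnP k (size (s a)); last first.
  by rewrite drop_oversize // !take_oversize // ltnW.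
have [b0 _] : exists b0 : B, True by move: ks; case: (s a) => // b0; exists b0.
rewrite (drop_nth b0 ks) map_cons logn_code.
case Ec: (CodeSeq.code _) => [|c].
  by have := size_code (pickle (nth b0 (s a) k) :: [seq pickle x | x <- drop k.+1 (s a)]);
     rewrite Ec.
by rewrite (take_nth b0 ks) foldl_rcons -(HF (a, _, _)).
Qed.

End tcomp_rec.

Section tcomp_seq.
Variables (A B : countType).

Lemma tcomp_all (p : A -> B -> bool) (s : A -> seq B) :
  tcomp (fun x : A * B => p x.1 x.2) -> tcomp s -> tcomp (fun a => all (p a) (s a)).
Proof.
move=> cp cs.
apply: (@eq_tcomp _ _ (fun a => foldl (fun z b => z && p a b) true (s a))).
  move=> a; rewrite -[RHS]andTb.
  by elim: (s a) true => [|b l IH] t /=; rewrite ?andbT // IH andbA.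
apply: (tcomp_foldl (f := fun a z b => z && p a b)) => //; last exact: tcomp_const.
apply: tcomp_and; first by apply/tcomp_snd/tcomp_fst/tcomp_id.
apply: (tcomp_comp (h := fun x => p x.1 x.2) (f := fun x => (x.1.1, x.2))) => //.
by apply: tcomp_pair; [do 2!apply: tcomp_fst; exact: tcomp_id|apply/tcomp_snd/tcomp_id].
Qed.

Lemma tcomp_has (p : A -> B -> bool) (s : A -> seq B) :
  tcomp (fun x : A * B => p x.1 x.2) -> tcomp s -> tcomp (fun a => has (p a) (s a)).
Proof.
move=> cp cs.
apply: (@eq_tcomp _ _ (fun a => foldl (fun z b => z || p a b) false (s a))).
  move=> a; rewrite -[RHS]orFb.
  by elim: (s a) false => [|b l IH] t /=; rewrite ?orbF // IH orbA.
apply: (tcomp_foldl (f := fun a z b => z || p a b)) => //; last exact: tcomp_const.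
apply: tcomp_or; first by apply/tcomp_snd/tcomp_fst/tcomp_id.
apply: (tcomp_comp (h := fun x => p x.1 x.2) (f := fun x => (x.1.1, x.2))) => //.
by apply: tcomp_pair; [do 2!apply: tcomp_fst; exact: tcomp_id|apply/tcomp_snd/tcomp_id].
Qed.

Lemma tcomp_bigsum (p : A -> B -> nat) (s : A -> seq B) :
  tcomp (fun x : A * B => p x.1 x.2) -> tcomp s ->
  tcomp (fun a => \sum_(b <- s a) p a b).
Proof.
move=> cp cs.
apply: (@eq_tcomp _ _ (fun a => foldl (fun z b => z + p a b) 0 (s a))).
  have H l a t : foldl (fun z b => z + p a b) t l = t + \sum_(b <- l) p a b.
    by elim: l t => [|b l IH] t /=; rewrite ?big_nil ?addn0 // IH big_cons addnA.
  by move=> a; rewrite H.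
apply: (tcomp_foldl (f := fun a z b => z + p a b)) => //; last exact: tcomp_const.
apply: tcomp_add; first by apply/tcomp_snd/tcomp_fst/tcomp_id.
apply: (tcomp_comp (h := fun x => p x.1 x.2) (f := fun x => (x.1.1, x.2))) => //.
by apply: tcomp_pair; [do 2!apply: tcomp_fst; exact: tcomp_id|apply/tcomp_snd/tcomp_id].
Qed.

Lemma tcomp_bigmax (p : A -> B -> nat) (s : A -> seq B) :
  tcomp (fun x : A * B => p x.1 x.2) -> tcomp s ->
  tcomp (fun a => \max_(b <- s a) p a b).
Proof.
move=> cp cs.
apply: (@eq_tcomp _ _ (fun a => foldl (fun z b => maxn z (p a b)) 0 (s a))).
  have H l a t : foldl (fun z b => maxn z (p a b)) t l = maxn t (\max_(b <- l) p a b).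
    by elim: l t => [|b l IH] t /=; rewrite ?big_nil ?maxn0 // IH big_cons maxnA.
  by move=> a; rewrite H max0n.
apply: (tcomp_foldl (f := fun a z b => maxn z (p a b))) => //; last exact: tcomp_const.
apply: tcomp_max; first by apply/tcomp_snd/tcomp_fst/tcomp_id.
apply: (tcomp_comp (h := fun x => p x.1 x.2) (f := fun x => (x.1.1, x.2))) => //.
by apply: tcomp_pair; [do 2!apply: tcomp_fst; exact: tcomp_id|apply/tcomp_snd/tcomp_id].
Qed.

Lemma tcomp_rev (s : A -> seq B) : tcomp s -> tcomp (fun a => rev (s a)).
Proof.
move=> cs.
apply: (@eq_tcomp _ _ (fun a => foldl (fun z b => b :: z) [::] (s a))).
  by move=> a; rewrite -(revK (s a)) foldl_rev revK; elim: (rev (s a)) => //= b l ->.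
apply: (tcomp_foldl (f := fun a z b => b :: z)) => //; last exact: tcomp_const.
by apply: tcomp_cons; [apply/tcomp_snd/tcomp_id|apply/tcomp_snd/tcomp_fst/tcomp_id].
Qed.

Lemma tcomp_size (s : A -> seq B) : tcomp s -> tcomp (fun a => size (s a)).
Proof.
move=> cs; apply: (@eq_tcomp _ _ (fun a => \sum_(b <- s a) 1)).
  by move=> a; rewrite sum1_size.
by apply: (tcomp_bigsum (p := fun _ _ => 1)) => //; exact: tcomp_const.
Qed.

End tcomp_seq.

Lemma tcomp_foldr (A B C : countType) (f : A -> B -> C -> C) (z : A -> C) (s : A -> seq B) :
  tcomp (fun x : A * C * B => f x.1.1 x.2 x.1.2) -> tcomp z -> tcomp s ->
  tcomp (fun a => foldr (f a) (z a) (s a)).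
Proof.
move=> cf cz cs.
apply: (@eq_tcomp _ _ (fun a => foldl (fun c b => f a b c) (z a) (rev (s a)))).
  by move=> a; rewrite foldl_rev.
by apply: (tcomp_foldl (f := fun a c b => f a b c)) => //; exact: tcomp_rev.
Qed.

Lemma tcomp_map (A B C : countType) (f : A -> B -> C) (s : A -> seq B) :
  tcomp (fun x : A * B => f x.1 x.2) -> tcomp s -> tcomp (fun a => [seq f a b | b <- s a]).
Proof.
move=> cf cs.
apply: (@eq_tcomp _ _ (fun a => foldr (fun b l => f a b :: l) [::] (s a))) => //.
apply: (tcomp_foldr (f := fun a b l => f a b :: l)) => //; last exact: tcomp_const.
apply: tcomp_cons; last by apply/tcomp_snd/tcomp_fst/tcomp_id.
apply: (tcomp_comp (h := fun x => f x.1 x.2) (f := fun x => (x.1.1, x.2))) => //.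
by apply: tcomp_pair; [do 2!apply: tcomp_fst; exact: tcomp_id|apply/tcomp_snd/tcomp_id].
Qed.

Lemma tcomp_cat (A B : countType) (s t : A -> seq B) :
  tcomp s -> tcomp t -> tcomp (fun a => s a ++ t a).
Proof.
move=> cs ct.
apply: (@eq_tcomp _ _ (fun a => foldr (fun b l => b :: l) (t a) (s a))).
  by move=> a; elim: (s a) => //= b l ->.
apply: (tcomp_foldr (f := fun a b l => b :: l)) => //.
by apply: tcomp_cons; [apply/tcomp_snd/tcomp_id|apply/tcomp_snd/tcomp_fst/tcomp_id].
Qed.

Lemma tcomp_flatten (A B : countType) (s : A -> seq (seq B)) :
  tcomp s -> tcomp (fun a => flatten (s a)).
Proof.
move=> cs; rewrite /flatten.
apply: (tcomp_foldr (f := fun a => cat)) => //; last exact: tcomp_const.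
by apply: tcomp_cat; [apply/tcomp_snd/tcomp_id|apply/tcomp_snd/tcomp_fst/tcomp_id].
Qed.

Lemma tcomp_behead (A B : countType) (s : A -> seq B) :
  tcomp s -> tcomp (fun a => behead (s a)).
Proof.
move=> [g cg Hg]; exists (fun n => code_tail (g n)); first exact: crec_tail.
by move=> a; rewrite Hg; case: (s a) => // b l; rewrite pickle_seqE map_cons code_tailE.
Qed.

Lemma tcomp_head (A B : countType) (x0 : B) (s : A -> seq B) :
  tcomp s -> tcomp (fun a => head x0 (s a)).
Proof.
move=> [g cg Hg]; exists (fun n => if g n is 0 then pickle x0 else logn 2 (g n)).
  by apply: crec_if => //; [exact: crec_const|exact: crec_log2].
move=> a; rewrite Hg; case: (s a) => // b l; rewrite pickle_seqE map_cons logn_code.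
by have := size_code (pickle b :: [seq pickle x | x <- l]); case: CodeSeq.code.
Qed.

Lemma tcomp_nth (A B : countType) (x0 : B) (s : A -> seq B) (n : A -> nat) :
  tcomp s -> tcomp n -> tcomp (fun a => nth x0 (s a) (n a)).
Proof.
move=> cs cn.
apply: (@eq_tcomp _ _ (fun a => head x0 (nat_rect _ (s a) (fun _ l => behead l) (n a)))).
  move=> a; rewrite -nth0; have -> : nat_rect _ (s a) (fun _ l => behead l) (n a) = drop (n a) (s a).
    by elim: (n a : nat) => [|k /= ->]; rewrite ?drop0 // -drop1 drop_drop add1n.
  by rewrite nth_drop addn0.
apply: tcomp_head; apply: (tcomp_natrec (f := fun a _ l => behead l)) => //.
by apply/tcomp_behead/tcomp_snd/tcomp_id.
Qed.

Lemma tcomp_iota0 (A : countType) (n : A -> nat) :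
  tcomp n -> tcomp (fun a => iota 0 (n a)).
Proof.
move=> cn.
apply: (@eq_tcomp _ _ (fun a => rev (nat_rect (fun=> seq nat) [::] (fun i l => i :: l) (n a)))).
  move=> a; elim: (n a : nat) => [|k IH] //.
  by rewrite -[in RHS]addn1 iotaD -IH /= rev_cons cats1.
apply: tcomp_rev; apply: (tcomp_natrec (f := fun a i l => i :: l)) => //; last exact: tcomp_const.
by apply: tcomp_cons; [apply/tcomp_snd/tcomp_fst/tcomp_id|apply/tcomp_snd/tcomp_id].
Qed.

Lemma tcomp_of_pickle (A B : countType) (f : A -> B) :
  tcomp (fun a => pickle (f a)) -> tcomp f.
Proof. by move=> [g cg Hg]; exists g. Qed.

Lemma tcomp_code2 (A : countType) (f g : A -> nat) : tcomp f -> tcomp g ->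
  tcomp (fun a => CodeSeq.code [:: f a; g a]).
Proof. by move=> cf cg; exact: (tcomp_comp (tcomp_pickle _) (tcomp_pair cf cg)). Qed.

Lemma tcomp_decode (A : countType) (f : A -> nat) : tcomp f ->
  tcomp (fun a => CodeSeq.decode (f a)).
Proof.
move=> cf; apply: tcomp_of_pickle; apply: eq_tcomp cf => a.
by rewrite pickle_seqE map_id CodeSeq.decodeK.
Qed.

Lemma tcomp_dvd (A : countType) (f g : A -> nat) : tcomp f -> tcomp g ->
  (forall a, 0 < g a) -> tcomp (fun a => g a %| f a).
Proof.
move=> cf cg g0; apply: (@eq_tcomp _ _ (fun a => f a %/ g a * g a == f a)).
  by move=> a; rewrite dvdn_eq.
by apply: tcomp_eq => //; apply: tcomp_mul => //; exact: tcomp_div.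
Qed.

(** A common divisor other than 1, if any, can be taken to be the gcd, which lies between 2 and [d];
    writing it as [k.+2] makes a bounded search over [k] decide coprimality. *)
Lemma coprime_has m d : 0 < d ->
  coprime m d = (has (fun k => (k.+2 %| m) && (k.+2 %| d)) (iota 0 d) == false).
Proof.
move=> d0; apply/idP/eqP => [cmd|H].
  apply/hasP => -[k _ /andP[km kd]].
  have : k.+2 %| gcdn m d by rewrite dvdn_gcd km.
  by rewrite (eqP cmd) dvdn1.
apply/negPn/negP => nc; move/negbT/hasPn: H => /(_ (gcdn m d - 2)).
have g0 : 0 < gcdn m d by rewrite gcdn_gt0 d0 orbT.
have g1 : gcdn m d != 1 by apply: contra nc.
have gE : (gcdn m d - 2).+2 = gcdn m d by lia.
rewrite gE dvdn_gcdl dvdn_gcdr mem_iota /= add0n => H.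
suff /H : gcdn m d - 2 < d by [].
by have := dvdn_leq d0 (dvdn_gcdr m d); lia.
Qed.

Lemma tcomp_coprime (A : countType) (f g : A -> nat) : tcomp f -> tcomp g ->
  tcomp (fun a => (0 < g a) && coprime (f a) (g a)).
Proof.
move=> cf cg.
apply: (@eq_tcomp _ _ (fun a => (0 < g a) &&
  (has (fun k => (k.+2 %| f a) && (k.+2 %| g a)) (iota 0 (g a)) == false))).
  by move=> a; case: posnP => // g0; rewrite coprime_has.
apply: tcomp_and; first by apply: (tcomp_leq (f := fun=> 1)) => //; exact: tcomp_const.
apply: tcomp_eq; last exact: tcomp_const.
apply: (tcomp_has (p := fun a k => (k.+2 %| f a) && (k.+2 %| g a))); last exact: tcomp_iota0.
have ck : tcomp (fun x : A * nat => x.2.+2).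
  by do 2!apply: tcompS; apply/tcomp_snd/tcomp_id.
by apply: tcomp_and; apply: tcomp_dvd => //;
   (apply: tcomp_comp; [|apply/tcomp_fst/tcomp_id]).
Qed.

(** A rational is handled as [(posq - negq) / denn] with natural numbers, so that comparisons become
    inequalities in [nat] after moving the negative part to the other side. *)
Definition posq (q : rat) : nat := if numq q is Posz n then n else 0.
Definition negq (q : rat) : nat := if numq q is Negz n then n.+1 else 0.
Definition denn (q : rat) : nat := `|denq q|%N.

Lemma denn_gt0 q : 0 < denn q.
Proof. by rewrite /denn absz_gt0 denq_eq0. Qed.

Lemma tcomp_posq (A : countType) (q : A -> rat) : tcomp q -> tcomp (fun a => posq (q a)).
Proof.
(* The three heads lead to the numerator, its nonnegative component and the content of that. For a
   negative numerator the component is the code 0 of the empty list, and [logn 2 0] is the wanted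
   0. *)
move=> [g cg Hg]; exists (fun n => logn 2 (logn 2 (logn 2 (g n)))).
  by do 3!apply: crec_log2.
move=> a; rewrite Hg pickle_ratE logn_code /posq.
by case: (numq (q a)) => n; rewrite ?pickle_PoszE ?pickle_NegzE !logn_code.
Qed.

Lemma tcomp_denn (A : countType) (q : A -> rat) : tcomp q -> tcomp (fun a => denn (q a)).
Proof.
move=> [g cg Hg]; exists (fun n => logn 2 (logn 2 (logn 2 (code_tail (g n))))).
  by do 3!apply: crec_log2; exact: crec_tail.
move=> a; rewrite Hg pickle_ratE code_tailE logn_code /denn.
by have := denq_gt0 (q a); case: (denq (q a)) => n // _; rewrite pickle_PoszE !logn_code.
Qed.

Lemma tcomp_negq (A : countType) (q : A -> rat) : tcomp q -> tcomp (fun a => negq (q a)).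
Proof.
move=> [g cg Hg].
exists (fun n => if logn 2 (code_tail (logn 2 (g n))) is 0 then 0
   else (logn 2 (logn 2 (code_tail (logn 2 (g n))))).+1).
  have c : crec (fun v : 1.-tuple nat => logn 2 (code_tail (logn 2 (g (thead v))))).
    by apply/crec_log2/crec_tail/crec_log2.
  by apply: crec_if => //; [exact: crec_const|apply/crecS/crec_log2].
move=> a; rewrite Hg pickle_ratE logn_code /negq.
case: (numq (q a)) => n; rewrite ?pickle_PoszE ?pickle_NegzE code_tailE !logn_code //.
by have := size_code [:: n]; case: CodeSeq.code.
Qed.

(** * Computable surjections, and enumerable sets as unions of stages *)

Definition tsurj (T : countType) : Prop :=
  exists2 e : nat -> T, tcomp e & forall x, exists n, e n = x.

Lemma tsurj_bool : tsurj bool.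
Proof.
exists (fun n => n == 0); last by case; [exists 0|exists 1].
by apply: tcomp_eq; [exact: tcomp_id|exact: tcomp_const].
Qed.

Lemma tsurj_seq (T : countType) : tsurj T -> tsurj (seq T).
Proof.
move=> [e ce He]; exists (fun n => [seq e k | k <- CodeSeq.decode n]).
  apply: (tcomp_map (f := fun _ k => e k)); last by apply/tcomp_decode/tcomp_id.
  by apply: tcomp_comp => //; apply/tcomp_snd/tcomp_id.
move=> s; have /choice[h Hh] := He.
exists (CodeSeq.code (map h s)).
by rewrite CodeSeq.codeK -map_comp -[RHS]map_id; apply: eq_map => x /=.
Qed.

Lemma tsurj_prod (T U : countType) : tsurj T -> tsurj U -> tsurj (T * U)%type.
Proof.
move=> [e ce He] [e' ce' He'].
exists (fun n => (e (nth 0 (CodeSeq.decode n) 0), e' (nth 0 (CodeSeq.decode n) 1))).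
  have c i : tcomp (fun n => nth 0 (CodeSeq.decode n) i).
    by apply: tcomp_nth; [apply/tcomp_decode/tcomp_id|exact: tcomp_const].
  by apply: tcomp_pair; apply: tcomp_comp.
move=> [x y]; have [n <-] := He x; have [m <-] := He' y.
by exists (CodeSeq.code [:: n; m]); rewrite CodeSeq.codeK.
Qed.

Lemma tsurj_rat : tsurj rat.
Proof.
(* Only reduced fractions are used, so that no gcd has to be divided out. *)
pose z (l : seq nat) := if nth 0 l 0 == 0 then Posz (nth 0 l 1) else Negz (nth 0 l 1).
pose az (l : seq nat) := if nth 0 l 0 == 0 then nth 0 l 1 else (nth 0 l 1).+1.
have azE l : az l = `|z l|%N by rewrite /az /z; case: ifP.
pose d (l : seq nat) := nth 0 l 2.
pose e l : rat := if (0 < d l) && coprime (az l) (d l) then ((z l)%:~R / (d l)%:~R)%R else 0%R.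
have cn i : tcomp (fun l : seq nat => nth 0 l i).
  by apply: tcomp_nth; [exact: tcomp_id|exact: tcomp_const].
exists (fun n => e (CodeSeq.decode n)).
  apply: tcomp_comp; last by apply/tcomp_decode/tcomp_id.
  apply: tcomp_of_pickle.
  (* The code of the one-element list of [n] is $2^n$ and that of the empty list is 0, so [c1] and
     [c2] are the codes of [Posz n] and [Negz n]. *)
  pose c1 n := CodeSeq.code [:: 2 ^ n; 0].
  pose c2 n := CodeSeq.code [:: 0; 2 ^ n].
  apply: (@eq_tcomp _ _ (fun l => if (0 < d l) && coprime (az l) (d l) then
     CodeSeq.code [:: (if nth 0 l 0 == 0 then c1 (nth 0 l 1) else c2 (nth 0 l 1));
     c1 (d l)] else pickle (0%R : rat))).
    move=> l; rewrite /e; case: ifP => // /andP[d0 cop].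
    have cop' : coprime `|z l| `|Posz (d l)| by rewrite -azE.
    rewrite pickle_ratE coprimeq_num // coprimeq_den //.
    have -> : (Posz (d l) == 0)%R = false by lia.
    have -> : (Num.sg (d l : int) * z l = z l)%R by rewrite gtr0_sg ?mul1r //; lia.
    have c1E n : pickle (Posz n) = c1 n.
      by rewrite pickle_PoszE /c1; congr CodeSeq.code; rewrite /CodeSeq.code /= muln1.
    have c2E n : pickle (Negz n) = c2 n.
      by rewrite pickle_NegzE /c2; congr CodeSeq.code; rewrite /CodeSeq.code /= muln1.
    congr CodeSeq.code; congr [:: _; _]; last by rewrite -c1E.
    by rewrite /z; case: ifP => _; rewrite ?c1E ?c2E.
  have ce2 i : tcomp (fun l : seq nat => 2 ^ nth 0 l i) by exact: tcomp_exp2.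
  have c0 n : tcomp (fun l : seq nat => n : nat) by exact: tcomp_const.
  have cb : tcomp (fun l : seq nat => nth 0 l 0 == 0) by exact: tcomp_eq.
  apply: tcomp_if; [|apply: tcomp_code2|exact: tcomp_const].
  - apply: tcomp_coprime; last exact: (cn 2).
    by apply: tcomp_if => //; exact: tcompS.
  - by apply: tcomp_if => //; apply: tcomp_code2.
  - by apply: tcomp_code2 => //; exact: (ce2 2).
move=> q.
have dE : Posz `|denq q|%N = denq q by have := denq_gt0 q; lia.
pose l := match numq q with Posz n => [:: 0; n; `|denq q|%N] | Negz n => [:: 1; n; `|denq q|%N] end.
exists (CodeSeq.code l); rewrite CodeSeq.codeK.
have zl : z l = numq q by rewrite /z /l; case: (numq q).
have dl : d l = `|denq q|%N by rewrite /d /l; case: (numq q).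
rewrite /e azE zl dl coprime_num_den absz_gt0 denq_eq0 /=.
by rewrite dE divq_num_den.
Qed.

Lemma enumerable_stages (T : countType) (W : set T) : enumerable W ->
  exists E : nat -> seq T, [/\ tcomp E, forall m n, m <= n -> {subset E m <= E n}
    & forall x, W x <-> exists n, x \in E n].
Proof.
move=> [f Hf].
pose ev N i := evalf f N [tuple i].
have evW N i c : ev N i = c.+1 -> exists2 x, W x & pickle x = c.
  move=> E.
  have : [set y | exists n, rec_eval f [tuple n] y]%classic c.
    by exists i; apply/evalfP; exists N.
  by rewrite Hf.
pose step N i (l : seq T) := if ev N i is c.+1 then
   (if pickle_inv c is Some x then x :: l else l) else l.
pose E N := nat_rect (fun=> seq T) [::] (step N) N.
have ME x N : (x \in E N) <-> exists2 i, i < N & ev N i = (pickle x).+1.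
  (* Only the number of inputs tried is generalised for the induction; the fuel stays [N]. *)
  rewrite /E; move: {2 3}N => k; elim: k => [|k IH] /=; first by split => // -[].
  rewrite {1}/step; case Ek: (ev N k) => [|c].
    rewrite IH; split=> -[i ik Ei]; exists i => //; first exact: ltnW.
    by rewrite ltn_neqAle -ltnS ik andbT; apply/eqP => ik'; rewrite -ik' Ei in Ek.
  have [y Wy yc] := evW _ _ _ Ek; rewrite -yc pickleK_inv inE; split.
    move=> /predU1P[->|/IH[i ik Ei]]; first by exists k => //; rewrite Ek yc.
    by exists i => //; exact: ltnW.
  move=> [i]; rewrite ltnS leq_eqVlt => /predU1P[->|ik Ei].
    by rewrite Ek -yc => -[/(pcan_inj pickleK) ->]; rewrite eqxx.
  by apply/orP; right; apply/IH; exists i.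
exists E; split.
- apply: (tcomp_natrec (f := step)); [|exact: tcomp_const|exact: tcomp_id].
  apply: tcomp_of_pickle.
  pose e (x : nat * nat * seq T) := ev x.1.1 x.1.2.
  (* Every value of [f] is already the code of an element, so it is prepended to the coded list
     arithmetically, without decoding. *)
  apply: (@eq_tcomp _ _ (fun x => if e x == 0 then pickle x.2 else
     2 ^ (e x).-1 * (2 * pickle x.2).+1)).
    move=> [[N i] l]; rewrite /step /e /=; case E1: (ev N i) => [|c] //=.
    have [y Wy <-] := evW _ _ _ E1; rewrite pickleK_inv mul2n; reflexivity.
  have ce : tcomp e.
    apply: (@tcomp_nat2 _ ev); [|apply/tcomp_fst/tcomp_fst/tcomp_id|apply/tcomp_snd/tcomp_fst/tcomp_id].
    apply: (@eq_crec _ (fun v : 2.-tuple nat => evalf f (tnth v ord0) [tuple tnth v ord_max | _ < 1])).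
      by move=> v; congr evalf; apply: eq_from_tnth => i; rewrite tnth_mktuple ord1.
    apply: (@crec_evalf _ f 2 (fun v => tnth v ord0) (fun _ v => tnth v ord_max)) => [|_]; exact: crec_proj.
  have cp : tcomp (fun x : nat * nat * seq T => pickle x.2).
    by apply: tcomp_comp; [exact: tcomp_pickle|apply/tcomp_snd/tcomp_id].
  apply: tcomp_if => //; first by apply: tcomp_eq => //; exact: tcomp_const.
  apply: tcomp_mul; first by apply/tcomp_exp2/tcomp_pred.
  by apply/tcompS/tcomp_mul => //; exact: tcomp_const.
- move=> m n mn x /ME[i im Ei]; apply/ME; exists i; first exact: leq_trans mn.
  exact: evalf_mono Ei.
- move=> x; split.
    move=> Wx; have : [set pickle x | x in W]%classic (pickle x) by exists x.
    rewrite -Hf => -[i /evalfP[s Hs]]; exists (maxn s i.+1); apply/ME; exists i.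
      by rewrite leq_max leqnn orbT.
    by apply: evalf_mono Hs; exact: leq_maxl.
  by move=> [n /ME[i _ /evW[y Wy /(pcan_inj pickleK) <-]]].
Qed.

(** An input codes a candidate, produced by the computable surjection onto [T], and a stage; the
    candidate is output if the stage confirms it, and a fixed element of [A] otherwise. The empty
    set is the range of a search that never ends. *)
Lemma enumerable_of_stages (T : countType) (A : set T) (D : T -> nat -> bool) :
  tsurj T -> tcomp (fun x : T * nat => D x.1 x.2) ->
  (forall x, A x <-> exists n, D x n) -> enumerable A.
Proof.
move=> [e ce He] cD HD.
have [A0|/set0P[a0 Aa0]] := eqVneq A set0.
  have [es Hes] : crec (fun _ : 2.-tuple nat => 1) by exact: crec_const.
  exists (RMu es); rewrite A0 image_set0; apply/seteqP; split => // y [n] /= [H _].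
  by have := rec_eval_fun H (Hes _).
pose x n := e (nth 0 (CodeSeq.decode n) 0).
pose m n := nth 0 (CodeSeq.decode n) 1.
have cn i : tcomp (fun n => nth 0 (CodeSeq.decode n) i).
  by apply: tcomp_nth; [apply/tcomp_decode/tcomp_id|exact: tcomp_const].
have cx : tcomp x by apply: tcomp_comp.
have [g [eg Heg] Hg] : tcomp (fun n => if D (x n) (m n) then x n else a0).
  apply: tcomp_if => //; last exact: tcomp_const.
  exact: (tcomp_comp cD (tcomp_pair cx (cn 1))).
exists eg; apply/seteqP; split=> [y [n Hy]|_ [a Aa <-]].
  have -> : y = g n by have := rec_eval_fun Hy (Heg _).
  rewrite -[n]/(pickle n) Hg; case: ifPn => HDn.
    by exists (x n) => //; apply/HD; exists (m n).
  by exists a0.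
have /HD[k Dk] := Aa; have [j Hj] := He a.
exists (CodeSeq.code [:: j; k]).
have := Heg [tuple CodeSeq.code [:: j; k]]; congr rec_eval.
rewrite /thead (tnth_nth 0) /= -[X in g X]/(pickle (CodeSeq.code [:: j; k])) Hg.
by rewrite /x /m CodeSeq.codeK /= Hj Dk.
Qed.

Definition listsn (T : Type) (n : nat) (s : seq T) : seq (seq T) :=
  nat_rect _ [:: [::]] (fun _ L => flatten [seq [seq x :: l | l <- L] | x <- s]) n.

Lemma mem_listsn (T : eqType) n (s l : seq T) :
  (l \in listsn n s) = (size l == n) && all (mem s) l.
Proof.
elim: n l => [|n IH] l /=; first by rewrite inE; case: l.
apply/flatten_mapP/andP => [[x xs /mapP[l' ]]|].
  by rewrite IH => /andP[/eqP <- ls] ->; rewrite /= eqxx xs.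
case: l => [[]//|x l /= [/eqP[sl] /andP[xs ls]]]; exists x => //.
by apply/mapP; exists l => //; rewrite IH sl eqxx.
Qed.

Lemma uniq_listsn (T : eqType) n (s : seq T) : uniq s -> uniq (listsn n s).
Proof.
move=> us; elim: n => //= n IH.
apply: (@allpairs_uniq _ _ _ cons s (listsn n s)) => //.
by move=> [x l] [x' l'] _ _ [-> ->].
Qed.

Lemma size_listsn (T : Type) n (s : seq T) : size (listsn n s) = size s ^ n.
Proof.
elim: n => //= n IH.
by rewrite (size_allpairs cons s (listsn n s)) IH expnS.
Qed.

Lemma tcomp_listsn (A B : countType) (n : A -> nat) (s : A -> seq B) :
  tcomp n -> tcomp s -> tcomp (fun a => listsn (n a) (s a)).
Proof.
move=> cn cs.
apply: (tcomp_natrec (f := fun a _ L => flatten [seq [seq x :: l | l <- L] | x <- s a])) => //.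
  apply: tcomp_flatten.
  apply: (tcomp_map (f := fun (a : A * nat * seq (seq B)) x => [seq x :: l | l <- a.2])); last first.
    by apply: (tcomp_comp cs); apply/tcomp_fst/tcomp_fst/tcomp_id.
  apply: (tcomp_map (f := fun (a : A * nat * seq (seq B) * B) l => a.2 :: l)).
    by apply: tcomp_cons; [apply/tcomp_snd/tcomp_fst/tcomp_id|apply/tcomp_snd/tcomp_id].
  by apply/tcomp_snd/tcomp_fst/tcomp_id.
exact: tcomp_const.
Qed.

Lemma tcomp_prefix (A : countType) (s t : A -> seq bool) : tcomp s -> tcomp t ->
  tcomp (fun a => prefix (s a) (t a)).
Proof.
move=> cs ct.
apply: (@eq_tcomp _ _ (fun a => (size (s a) <= size (t a)) &&
  all (fun i => nth false (s a) i == nth false (t a) i) (iota 0 (size (s a))))).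
  move=> a; rewrite prefixE; apply/andP/eqP => [[st /allP H]|H].
    apply: (@eq_from_nth _ false); rewrite size_takel // => i ist.
    by rewrite nth_take //; apply/esym/eqP/H; rewrite mem_iota.
  split; first by rewrite -H size_take; case: ltnP => // /ltnW.
  apply/allP => i; rewrite mem_iota /= add0n => ist.
  by rewrite -[in X in X == _]H nth_take.
apply: tcomp_and; first by apply: tcomp_leq; exact: tcomp_size.
apply: (tcomp_all (p := fun a i => nth false (s a) i == nth false (t a) i)); last first.
  by apply/tcomp_iota0/tcomp_size.
apply: tcomp_eq; (apply: tcomp_nth; last by apply/tcomp_snd/tcomp_id);
  (apply: tcomp_comp; [|apply/tcomp_fst/tcomp_id]) => //.
Qed.

(** * Discretised covers *)

(* The floor of 2^N max(q, 0). *)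
Definition floorq N (q : rat) : nat := (posq q * 2 ^ N) %/ denn q.

(* 2^N times the N-th lower approximation of t on the cylinder of x, where E  *)
(* enumerates the pairs (r, z) such that t > r on the cylinder of z.          *)
Definition tau (E : nat -> seq (rat * seq bool)) N (x : seq bool) : nat :=
  \max_(rz <- E N) (if prefix rz.2 x then floorq N rz.1 else 0).

Definition words N := listsn N [:: true; false].

(** Rounding $K q(x)$ down on $2^N$ words loses at most $2^N$ in total, so with $K=4^N+2^N$ at least
    $4^N$ units remain to be listed. *)
Definition mass N := 2 ^ (N + N) + 2 ^ N.

Definition occ (y : seq bool) (L : seq (seq bool)) : nat := \sum_(x <- L) prefix y x.

(** The slack $2^N$ is on the upper side only: a sample drawn by rounding $Q$ down satisfies $n\le
    K\,Q(y)\le n+2^N$. The bound on the size of $y$ makes words of length $N$ decide whether they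
    extend $y$. *)
Definition sample_sat N L (c : condition) : bool :=
  [&& size c.1.1 <= N,
   posq c.1.2 * mass N < occ c.1.1 L * denn c.1.2 + negq c.1.2 * mass N &
   (occ c.1.1 L + 2 ^ N) * denn c.2 + negq c.2 * mass N < posq c.2 * mass N].

(** The factor $2^N$ beside the mass compensates the scaling of [tau]. *)
Definition cover_stage E (F : seq (seq condition)) N : bool :=
  all (fun L => (mass N * 2 ^ N < \sum_(x <- L) tau E N x) ||
       has (fun b => all (sample_sat N L) b) F)
    (listsn (2 ^ (N + N)) (words N)).

Section tcomp_test.
Variable A : countType.

Lemma tcomp_tau E (N : A -> nat) (x : A -> seq bool) : tcomp E ->
  tcomp N -> tcomp x -> tcomp (fun a => tau E (N a) (x a)).
Proof.
move=> cE cN cx.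
apply: (tcomp_bigmax (p := fun a (rz : rat * seq bool) =>
  if prefix rz.2 (x a) then floorq (N a) rz.1 else 0)); last exact: tcomp_comp.
apply: tcomp_if; last exact: tcomp_const.
  apply: tcomp_prefix; first by apply/tcomp_snd/tcomp_snd/tcomp_id.
  by apply: (tcomp_comp cx); apply/tcomp_fst/tcomp_id.
have cq : tcomp (fun y : A * (rat * seq bool) => y.2.1).
  by apply/tcomp_fst/tcomp_snd/tcomp_id.
apply: tcomp_div; [|exact: tcomp_denn|by move=> y; exact: denn_gt0].
apply: tcomp_mul; first exact: tcomp_posq.
by apply: tcomp_exp2; apply: (tcomp_comp cN); apply/tcomp_fst/tcomp_id.
Qed.

Lemma tcomp_mass (N : A -> nat) : tcomp N -> tcomp (fun a => mass (N a)).
Proof.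
by move=> cN; apply: tcomp_add; apply: tcomp_exp2 => //; exact: tcomp_add.
Qed.

Lemma tcomp_words (N : A -> nat) : tcomp N -> tcomp (fun a => words (N a)).
Proof. by move=> cN; apply: tcomp_listsn => //; exact: tcomp_const. Qed.

Lemma tcomp_occ (y : A -> seq bool) (L : A -> seq (seq bool)) :
  tcomp y -> tcomp L -> tcomp (fun a => occ (y a) (L a)).
Proof.
move=> cy cL; apply: (tcomp_bigsum (p := fun a x => (prefix (y a) x : nat))) => //.
apply: (@tcomp_comp _ _ _ (fun b : bool => b : nat)); first exact: tcomp_pickle.
by apply: tcomp_prefix; [apply: (tcomp_comp cy); apply/tcomp_fst/tcomp_id|
  apply/tcomp_snd/tcomp_id].
Qed.

Lemma tcomp_sample_sat (N : A -> nat) (L : A -> seq (seq bool)) (c : A -> condition) :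
  tcomp N -> tcomp L -> tcomp c -> tcomp (fun a => sample_sat (N a) (L a) (c a)).
Proof.
move=> cN cL cc.
have cy : tcomp (fun a => (c a).1.1) by do 2!apply: tcomp_fst.
have cu : tcomp (fun a => (c a).1.2) by apply/tcomp_snd/tcomp_fst.
have cv : tcomp (fun a => (c a).2) by exact: tcomp_snd.
have co := tcomp_occ cy cL.
have cm := tcomp_mass cN.
apply: tcomp_and; first by apply: tcomp_leq => //; exact: tcomp_size.
apply: tcomp_and.
  apply: (tcomp_leq (f := fun a => (posq (c a).1.2 * mass (N a)).+1)).
    by apply/tcompS/tcomp_mul => //; exact: tcomp_posq.
  apply: tcomp_add; apply: tcomp_mul => //; [exact: tcomp_denn|exact: tcomp_negq].
apply: (tcomp_leq (f := fun a => ((occ (c a).1.1 (L a) + 2 ^ N a) * denn (c a).2 + negq (c a).2 * mass (N a)).+1)).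
  apply/tcompS/tcomp_add; apply: tcomp_mul => //.
  - by apply: tcomp_add => //; exact: tcomp_exp2.
  - exact: tcomp_denn.
  - exact: tcomp_negq.
by apply: tcomp_mul => //; exact: tcomp_posq.
Qed.

End tcomp_test.

Lemma tcomp_cover_stage E : tcomp E ->
  tcomp (fun x : seq (seq condition) * nat => cover_stage E x.1 x.2).
Proof.
move=> cE; set X := (_ * nat)%type.
apply: (tcomp_all (p := fun (a : X) L => (mass a.2 * 2 ^ a.2 < \sum_(x <- L) tau E a.2 x) ||
       has (fun b => all (sample_sat a.2 L) b) a.1)); last first.
  have cN : tcomp (fun x : X => x.2) by apply/tcomp_snd/tcomp_id.
  by apply: tcomp_listsn; [apply/tcomp_exp2/tcomp_add|exact: tcomp_words].
apply: tcomp_or.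
  have cN : tcomp (fun x : X * seq (seq bool) => x.1.2) by apply/tcomp_snd/tcomp_fst/tcomp_id.
  apply: (tcomp_leq (f := fun a : X * seq (seq bool) => (mass a.1.2 * 2 ^ a.1.2).+1)).
    by apply/tcompS/tcomp_mul; [exact: tcomp_mass|exact: tcomp_exp2].
  apply: (tcomp_bigsum (p := fun (a : X * seq (seq bool)) x => tau E a.1.2 x)); last first.
    by apply/tcomp_snd/tcomp_id.
  by apply: tcomp_tau => //; [apply/tcomp_snd/tcomp_fst/tcomp_fst/tcomp_id|apply/tcomp_snd/tcomp_id].
apply: (tcomp_has (p := fun (a : X * seq (seq bool)) b => all (sample_sat a.1.2 a.2) b));
  last by apply/tcomp_fst/tcomp_fst/tcomp_id.
apply: (tcomp_all (p := fun (a : X * seq (seq bool) * seq condition) c =>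
   sample_sat a.1.1.2 a.1.2 c)); last by apply/tcomp_snd/tcomp_id.
apply: tcomp_sample_sat.
- by apply/tcomp_snd/tcomp_fst/tcomp_fst/tcomp_fst/tcomp_id.
- by apply/tcomp_snd/tcomp_fst/tcomp_fst/tcomp_id.
- by apply/tcomp_snd/tcomp_id.
Qed.

Local Open Scope classical_set_scope.
Local Open Scope ring_scope.

(** * Measures with prescribed values on cylinders *)

Lemma cylinder_rcons y b (w : nat -> bool) :
  cylinder (rcons y b) w <-> cylinder y w /\ w (size y) = b.
Proof.
split=> [H|[Hy Hb] i].
  split=> [i iy|].
    by rewrite H ?size_rcons ?nth_rcons ?iy // ltnS ltnW.
  by rewrite H ?size_rcons ?nth_rcons ?ltnn ?eqxx.
rewrite size_rcons ltnS leq_eqVlt nth_rcons => /predU1P[->|iy].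
  by rewrite ltnn eqxx.
by rewrite iy; exact: Hy.
Qed.

Lemma cylinder_mkseq y (w : nat -> bool) : cylinder y w <-> mkseq w (size y) = y.
Proof.
split=> [H|<- i].
  apply: (@eq_from_nth _ false); rewrite size_mkseq // => i iy.
  by rewrite nth_mkseq // H.
by rewrite size_mkseq => iy; rewrite nth_mkseq.
Qed.

Lemma measurable_cylinder y : measurable (cylinder y : set Omega).
Proof. by apply: sub_sigma_algebra; exists y. Qed.

Section measure_of_weights.
Context (R : realType) (q : seq bool -> R).
Hypotheses (q_ge0 : forall y, 0 <= q y) (q_nil : q [::] = 1)
  (q_split : forall y, q y = q (rcons y false) + q (rcons y true)).

(** The left end of the interval assigned to [y]: the total length of the left siblings branched off
    along [y]. The intervals of the two children then divide that of their parent, and [bitat] tells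
    whether a point lies at or beyond the division point. *)
Let lo (y : seq bool) : R :=
  \sum_(i < size y) (if nth false y i then q (rcons (take i y) false) else 0).

Let lo_rcons y b : lo (rcons y b) = lo y + (if b then q (rcons y false) else 0).
Proof.
rewrite /lo size_rcons big_ord_recr /= nth_rcons ltnn eqxx -cats1 take_size_cat //.
congr (_ + _); apply: eq_bigr => i _; rewrite nth_cat ltn_ord take_cat ltn_ord //.
Qed.

Let bitat (u : R) (y : seq bool) : bool := lo y + q (rcons y false) <= u.

Let pre (u : R) (n : nat) : seq bool :=
  nat_rect _ [::] (fun _ y => rcons y (bitat u y)) n.

Let bits (u : measurableTypeR R) : Omega := fun n => bitat u (pre u n).

Let mkseq_bits u n : mkseq (bits u) n = pre u n.
Proof. by elim: n => //= n IH; rewrite mkseqS IH. Qed.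

Let bits_rcons u y b :
  cylinder (rcons y b) (bits u) <-> cylinder y (bits u) /\ bitat u y = b.
Proof.
split=> [/cylinder_rcons[cy <-]|[cy <-]]; last apply/cylinder_rcons; split => //.
  by move/cylinder_mkseq: cy; rewrite mkseq_bits /bits => ->.
by move/cylinder_mkseq: cy; rewrite mkseq_bits /bits => ->.
Qed.

(** By induction along the word, since reading one more bit cuts the current interval at the
    division point. Hence the image of Lebesgue measure on $[0,1)$ gives the cylinder of $y$ the
    length $q(y)$. *)
Let bits_cylinder y :
  bits @^-1` (cylinder y) `&` `[0, 1[ = [set` `[lo y, (lo y + q y)[].
Proof.
apply/seteqP; split=> u; rewrite /= !in_itv /=.
  elim/last_ind: y => [[_]|y b IH [/bits_rcons[cy]]].
    by rewrite /lo /= big_ord0 add0r q_nil.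
  rewrite /bitat => <- u01; have /andP[] := IH (conj cy u01).
  rewrite lo_rcons (q_split y); by have [h|h] := leP (lo y + q (rcons y false)) u; move: h; lra.
elim/last_ind: y => [|y b IH].
  by rewrite /lo /= big_ord0 add0r q_nil => ->; split.
rewrite lo_rcons => /andP[H1 H2].
have [] : (bits @^-1` cylinder y) u /\ (0 <= u < 1).
  have h0 := q_ge0 (rcons y false); have h1 := q_ge0 (rcons y true).
  apply: IH; move: H1 H2; rewrite (q_split y); case: b => /=; lra.
move=> cy u01; split=> //; apply/bits_rcons; split => //.
move: H1 H2; rewrite /bitat; case: b => /= H1 H2; first by lra.
by apply/negbTE; rewrite -ltNge; lra.
Qed.

Let measurable_bits_cylinder y : measurable (bits @^-1` (cylinder y)).
Proof.
elim/last_ind: y => [|y b IH].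
  rewrite (_ : _ @^-1` _ = setT); first exact: measurableT.
  by apply/seteqP; split => // u _ /= i.
have -> : bits @^-1` cylinder (rcons y b) =
    bits @^-1` cylinder y `&` [set u | bitat u y = b].
  by apply/seteqP; split => u /bits_rcons.
apply: measurableI => //.
have -> : [set u | bitat u y = b] =
   if b then [set` `[lo y + q (rcons y false), +oo[] else [set` `]-oo, lo y + q (rcons y false)[].
  apply/seteqP; split => u /=; rewrite /bitat; case: b => /=; rewrite in_itv /= ?andbT //.
  - by move/negbT; rewrite -ltNge.
  - by rewrite ltNge => /negbTE.
by case: b; exact: measurable_itv.
Qed.

Let measurable_bits : measurable_fun [set: measurableTypeR R] bits.
Proof.
apply: (@measurability _ _ (measurableTypeR R) Omega setT bits (range cylinder)) => //.
by move=> _ [_ [y _ <-] <-]; rewrite setTI; exact: measurable_bits_cylinder.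
Qed.

Let m01 : measurable (`[0, 1[%classic : set (measurableTypeR R)).
Proof. exact: measurable_itv. Qed.

Let unif := mrestr (@lebesgue_measure R) m01.

Let unif_setT : unif setT = 1%E.
Proof. by rewrite /unif /mrestr setTI /= lebesgue_measure_itv /= lte01 oppr0 adde0. Qed.

HB.instance Definition _ := Measure.on unif.
HB.instance Definition _ := Measure_isProbability.Build _ _ _ unif unif_setT.
HB.instance Definition _ := isMeasurableFun.Build _ _ _ _ bits measurable_bits.

Lemma exists_measure_of_weights :
  exists Q : measures R, forall y, Q (cylinder y) = (q y)%:E.
Proof.
exists (distribution unif bits) => y.
rewrite /distribution /pushforward /= /unif /mrestr bits_cylinder.
rewrite lebesgue_measure_itv /= lte_fin; case: ifPn => [_|].
  by rewrite -EFinB addrC addKr.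
(* The interval is empty here, and nonnegativity forces [q y] to be 0. *)
rewrite -leNgt gerDl => qy; congr EFin; apply/esym/le_anti.
by rewrite q_ge0 qy.
Qed.

End measure_of_weights.

(** * Words and the lower approximations of the test *)

Lemma mem_words N x : (x \in words N) = (size x == N).
Proof.
rewrite mem_listsn; case: eqP => //= _.
by apply/allP => -[] _; rewrite !inE.
Qed.

Lemma uniq_words N : uniq (words N).
Proof. exact: uniq_listsn. Qed.

Lemma size_words N : size (words N) = (2 ^ N)%N.
Proof. by rewrite size_listsn. Qed.

Lemma prefix_split y x : (size y < size x)%N ->
  (prefix y x = prefix (rcons y false) x + prefix (rcons y true) x :> nat)%N.
Proof.
elim: y x => [|b y IH] [|c x] //=; first by rewrite !prefix0s; case: c.
by rewrite ltnS => /IH H; case: eqP.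
Qed.

Lemma take_mkseq (T : Type) (w : nat -> T) n m : (n <= m)%N ->
  take n (mkseq w m) = mkseq w n.
Proof. by move=> nm; rewrite /mkseq -map_take take_iota (minn_idPl nm). Qed.

Lemma prefix_mkseq z (w : nat -> bool) N :
  prefix z (mkseq w N) <-> (size z <= N)%N /\ cylinder z w.
Proof.
rewrite prefixE cylinder_mkseq; split.
  move/eqP => H; have zN : (size z <= N)%N.
    by rewrite -H size_take size_mkseq; case: ltnP => // /ltnW.
  by split=> //; rewrite -[RHS]H take_mkseq.
by move=> [zN H]; rewrite take_mkseq // H.
Qed.

Section rat_parts.
Context (R : realType).

Lemma ratr_posq_negq (q : rat) :
  ratr q = ((posq q)%:R - (negq q)%:R) / (denn q)%:R :> R.
Proof.
rewrite /ratr; congr (_ / _).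
  by rewrite /posq /negq; case: (numq q) => n; rewrite ?subr0 ?sub0r ?NegzE ?mulrNz.
by rewrite /denn -[in LHS](absz_denq q).
Qed.

Lemma dennR_gt0 (q : rat) : 0 < (denn q)%:R :> R.
Proof. by rewrite ltr0n denn_gt0. Qed.

Lemma floorq_le N q : (floorq N q)%:R <= (posq q)%:R / (denn q)%:R * 2 ^+ N :> R.
Proof.
rewrite mulrAC ler_pdivlMr ?dennR_gt0 // -natrX -!natrM ler_nat.
exact: leq_trunc_div.
Qed.

Lemma floorq_gt N q : ratr q * 2 ^+ N < (floorq N q)%:R + 1 :> R.
Proof.
apply: (@le_lt_trans _ _ ((posq q)%:R / (denn q)%:R * 2 ^+ N)).
  rewrite ratr_posq_negq ler_wpM2r ?exprn_ge0 // ler_wpM2r ?invr_ge0 ?ler0n //.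
  by rewrite lerBlDr lerDl.
rewrite mulrAC ltr_pdivrMr ?dennR_gt0 // -natrX natr1 -!natrM ltr_nat.
exact: ltn_ceil (denn_gt0 q).
Qed.

End rat_parts.

Lemma posq_gt0_negq q : (0 < posq q)%N -> negq q = 0%N.
Proof. by rewrite /posq /negq; case: (numq q). Qed.

Lemma leq_tau E N r z x : (r, z) \in E N -> prefix z x ->
  (floorq N r <= tau E N x)%N.
Proof.
move=> rz zx; rewrite /tau.
have := leq_bigmax_seq (P := xpredT)
  (F := fun rz => if prefix rz.2 x then floorq N rz.1 else 0%N) _ rz isT.
by rewrite /= zx.
Qed.

(** After scaling, the approximations increase: later stages keep the earlier pairs, prefixes of
    [take n x] are prefixes of [x], and $2^k\lfloor a\rfloor\le\lfloor 2^k a\rfloor$. *)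
Lemma tau_mono E n N x : (forall m n, m <= n -> {subset E m <= E n})%N ->
  (n <= N)%N -> (tau E n (take n x) * 2 ^ (N - n) <= tau E N x)%N.
Proof.
move=> Emono nN; rewrite [tau E n _]/tau big_seq.
apply: (big_ind (fun k => k * 2 ^ (N - n) <= tau E N x)%N) => //.
  by move=> k l Hk Hl; rewrite maxnMl geq_max Hk.
move=> [r z] /= rz; case: ifPn => // pz.
apply: (@leq_trans (floorq N r)); last first.
  apply: (leq_tau (z := z)); first exact: Emono rz.
  by apply: prefix_trans pz _; rewrite -{2}(cat_take_drop n x) prefix_prefix.
rewrite /floorq leq_divRL ?denn_gt0 // mulnAC.
apply: (@leq_trans (posq r * 2 ^ n * 2 ^ (N - n))).
  by rewrite leq_mul2r leq_trunc_div orbT.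
by rewrite -mulnA -expnD subnKC.
Qed.

(** For the cylinder values of a measure this is $2^N$ times the integral of the $N$-th
    approximation. It is defined for arbitrary weights so as to apply to the frequencies of a
    sample, too. *)
Definition weight_sum (R : realType) E N (q : seq bool -> R) : R :=
  \sum_(x <- words N) (tau E N x)%:R * q x.

Lemma sum_words_prefix (R : realType) (q : seq bool -> R) N y :
  (forall y, q y = q (rcons y false) + q (rcons y true)) -> (size y <= N)%N ->
  \sum_(x <- words N) (prefix y x)%:R * q x = q y.
Proof.
move=> qD yN; move: {2}(N - size y)%N (erefl (N - size y)%N) => k.
elim: k y yN => [|k IH] y yN kE.
  have sy : size y = N by lia.
  rewrite (bigD1_seq y) ?uniq_words ?mem_words ?sy //= prefix_refl mul1r.
  rewrite big_seq_cond big1 ?addr0 // => x /andP[]; rewrite mem_words => /eqP sx xy.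
  by rewrite prefixE sy -sx take_size (negbTE xy) mul0r.
rewrite (qD y) -(IH (rcons y false)) ?size_rcons; [|lia|lia].
rewrite -(IH (rcons y true)) ?size_rcons; [|lia|lia].
rewrite -big_split /= [LHS]big_seq [RHS]big_seq; apply: eq_bigr => x.
rewrite mem_words => /eqP sx; rewrite -mulrDl -natrD prefix_split //; lia.
Qed.

Section lower_approximation.
Context (R : realType) (t : Omega -> \bar R) (E : nat -> seq (rat * seq bool)).
Hypothesis t_ge0 : forall w, (0 <= t w)%E.
Hypothesis E_mono : (forall m n, m <= n -> {subset E m <= E n})%N.
Hypothesis tE : forall r : rat, [set w | ((ratr r)%:E < t w)%E] =
  \bigcup_(x in [set x | exists n, (r, x) \in E n]) cylinder x.

Let s N (w : Omega) : R := (tau E N (mkseq w N))%:R / 2 ^+ N.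

Let s_ge0 N w : 0 <= s N w.
Proof. by rewrite divr_ge0 // exprn_ge0. Qed.

Let s_le N w : ((s N w)%:E <= t w)%E.
Proof.
rewrite /s /tau big_seq.
apply: (big_ind (fun k => ((k%:R / 2 ^+ N)%:E <= t w)%E)).
- by rewrite mul0r.
- by move=> k l Hk Hl; rewrite /maxn; case: ifP.
move=> [r z] /= rz; case: ifPn => [/prefix_mkseq[zN cz]|_]; last by rewrite mul0r.
case: (posnP (posq r)) => [p0|/posq_gt0_negq n0].
  by rewrite /floorq p0 mul0n div0n mul0r.
have : [set w | ((ratr r)%:E < t w)%E] w by rewrite tE; exists z => //; exists N.
move=> /ltW; apply: le_trans; rewrite lee_fin ler_pdivrMr ?exprn_gt0 //.
by rewrite ratr_posq_negq n0 subr0 floorq_le.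
Qed.

Let s_nd w : {homo (fun n => s n w) : n m / (n <= m)%N >-> n <= m}.
Proof.
move=> n m nm; rewrite /s ler_pdivrMr ?exprn_gt0 // mulrAC ler_pdivlMr ?exprn_gt0 //.
have := tau_mono (mkseq w m) E_mono nm; rewrite take_mkseq // -(ler_nat R) natrM natrX => H.
have -> : 2 ^+ m = 2 ^+ (m - n) * 2 ^+ n :> R by rewrite -exprD subnK.
by rewrite mulrA ler_pM2r ?exprn_gt0.
Qed.

(** If the supremum $S$ were below $t(w)$, a rational $r$ strictly between would appear at some
    stage on a cylinder around $w$; the rounding error $2^{-N}$ tends to 0, so the approximation
    would exceed $S$. *)
Let s_cvg w : (s n w)%:E @[n --> \oo] --> t w.
Proof.
have nd : nondecreasing_seq (fun n => (s n w)%:E).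
  by move=> n m nm; rewrite lee_fin s_nd.
have := ereal_nondecreasing_cvgn nd.
suff -> : ereal_sup (range (fun n => (s n w)%:E)) = t w by [].
set S := ereal_sup _.
have sS n : ((s n w)%:E <= S)%E by apply: ereal_sup_ubound; exists n.
apply/eqP; rewrite eq_le; apply/andP; split.
  by apply: ge_ereal_sup => _ [n _ <-]; exact: s_le.
rewrite leNgt; apply/negP => St.
have S0 : (0 <= S)%E by apply: le_trans (sS 0%N); rewrite lee_fin.
have [a Sa] : exists a, S = a%:E.
  by move: St S0 => {sS}; case: S => [a| |] //; [exists a|rewrite ltNge leey].
(* [t w] may be infinite, so a finite bound above [a] is chosen first. *)
have [b ab bt] : exists2 b, a < b & (b%:E <= t w)%E.
  move: St; rewrite Sa; case: (t w) => [b| |] //; first by exists b.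
  by exists (a + 1); rewrite ?leey // ltrDl.
have [r] := @rat_in_itvoo R _ _ ab; rewrite in_itv /= => /andP[ar rb].
have : [set w | ((ratr r)%:E < t w)%E] w.
  by apply: lt_le_trans bt; rewrite lte_fin.
rewrite tE => -[z [n0 rz] cz].
(* With $2^k>1/(r-a)$, the rounding error is smaller than the gap between [a] and [r]. *)
pose k := Num.bound (ratr r - a)^-1.
have ra : 0 < ratr r - a by rewrite subr_gt0.
have kr : (ratr r - a)^-1 < 2 ^+ k.
  apply: (@lt_le_trans _ _ k%:R).
    by apply: archi_boundP; rewrite invr_ge0 ltW.
  by rewrite -natrX ler_nat ltnW // ltn_expl.
pose N := maxn k (maxn n0 (size z)).
have kN : (2 ^+ k <= 2 ^+ N :> R).
  by rewrite ler_eXn2l ?ltr1n // leq_maxl.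
have rzN : (r, z) \in E N by apply: E_mono rz; rewrite /N; lia.
have zw : prefix z (mkseq w N) by apply/prefix_mkseq; split => //; rewrite /N; lia.
have := leq_tau rzN zw; rewrite -(ler_nat R) => Ht.
have Hf := floorq_gt R N r.
have := sS N; rewrite Sa lee_fin /s ler_pdivrMr ?exprn_gt0 // => Hs.
have : 1 < (ratr r - a) * 2 ^+ N.
  rewrite mulrC -ltr_pdivrMr // mul1r; exact: lt_le_trans kN.
rewrite mulrBl; lra.
Qed.

Let s_indic N w :
  (s N w)%:E = (\sum_(x <- words N) ((tau E N x)%:R / 2 ^+ N)%:E * (\1_(cylinder x) w)%:E)%E.
Proof.
rewrite (bigD1_seq (mkseq w N)) ?uniq_words ?mem_words ?size_mkseq //=.
rewrite indicE mem_set; last by apply/cylinder_mkseq; rewrite size_mkseq.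
rewrite mule1 big_seq_cond big1 ?adde0 // => x; rewrite mem_words => /andP[/eqP sx xw].
rewrite indicE memNset ?mule0 // => /cylinder_mkseq; rewrite sx => H.
by rewrite H eqxx in xw.
Qed.

Let measurable_s N : measurable_fun [set: Omega] (EFin \o s N).
Proof.
rewrite (_ : EFin \o _ = (fun w =>
  \sum_(x <- words N) ((tau E N x)%:R / 2 ^+ N)%:E * (\1_(cylinder x) w)%:E)%E); last first.
  by apply/funext => w; rewrite /= s_indic.
apply: emeasurable_sum => x; apply: emeasurable_funM; first exact: measurable_cst.
by apply/measurable_EFinP; apply: measurable_indic; exact: measurable_cylinder.
Qed.

Let integral_s (Q : measures R) N : (\int[Q]_w (s N w)%:E =
  (weight_sum E N (fun y => fine (Q (cylinder y))) / 2 ^+ N)%:E)%E.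
Proof.
under eq_integral do rewrite s_indic.
have mi x : measurable_fun [set: Omega] (EFin \o (\1_(cylinder x) : Omega -> R)).
  by apply/measurable_EFinP; apply: measurable_indic; exact: measurable_cylinder.
have c0 x : (0 <= ((tau E N x)%:R / 2 ^+ N : R)%:E)%E.
  by rewrite lee_fin divr_ge0 // exprn_ge0.
rewrite ge0_integral_sum //=; last first.
  by move=> x; apply: emeasurable_funM; [exact: measurable_cst|exact: mi].
rewrite /weight_sum mulr_suml -sumEFin; apply: eq_bigr => x _.
rewrite ge0_integralZl //; last exact: mi.
rewrite integral_indic ?setIT //; last exact: measurable_cylinder.
rewrite -[X in (_ * X)%E]fineK; last by apply: fin_num_measure; exact: measurable_cylinder.
by rewrite -EFinM mulrAC.
Qed.

(** Monotone convergence replaces the integral by finite sums. The resulting conditions are closed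
    in the cylinder values, which is what limits of measures and of samples can inherit. *)
Lemma integral_le1P (Q : measures R) : (\int[Q]_w t w <= 1)%E <->
  forall N, weight_sum E N (fun y => fine (Q (cylinder y))) <= 2 ^+ N.
Proof.
have tl : t = fun w => limn (fun n => (s n w)%:E).
  by apply/funext => w; apply/esym/cvg_lim => //; exact: s_cvg.
have sint N : (weight_sum E N (fun y => fine (Q (cylinder y))) <= 2 ^+ N) =
   (\int[Q]_w (s N w)%:E <= 1)%E.
  by rewrite integral_s lee_fin ler_pdivrMr ?exprn_gt0 // mul1r.
have nd : nondecreasing_seq (fun n => (\int[Q]_w (s n w)%:E)%E).
  move=> n m nm; apply: ge0_le_integral => //.
  - by move=> w _; rewrite lee_fin.
  - exact (measurable_s _).
  - exact (measurable_s _).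
  - by move=> w _; rewrite lee_fin s_nd.
have -> : (\int[Q]_w t w = limn (fun n => \int[Q]_w (s n w)%:E))%E.
  rewrite tl; apply: monotone_convergence => //.
  - by move=> n w _; rewrite lee_fin.
  - by move=> w _ n m nm; rewrite lee_fin s_nd.
split=> [H N|H].
  rewrite sint; apply: le_trans H.
  rewrite (cvg_lim _ (ereal_nondecreasing_cvgn nd)) //.
  by apply: ereal_sup_ubound; exists N.
apply: lime_le; first exact: ereal_nondecreasing_is_cvgn.
by near=> n; rewrite -sint.
Unshelve. all: by end_near.
Qed.

End lower_approximation.

Lemma ratr_lt_nat (R : realType) (u : rat) (K o : nat) :
  (ratr u * K%:R < o%:R :> R) = (posq u * K < o * denn u + negq u * K)%N.
Proof.
rewrite ratr_posq_negq mulrAC ltr_pdivrMr ?dennR_gt0 // mulrBl ltrBlDr.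
by rewrite -!natrM -natrD ltr_nat.
Qed.

Lemma nat_lt_ratr (R : realType) (v : rat) (K o : nat) :
  (o%:R < ratr v * K%:R :> R) = (o * denn v + negq v * K < posq v * K)%N.
Proof.
rewrite ratr_posq_negq mulrAC ltr_pdivlMr ?dennR_gt0 // mulrBl ltrBrDr.
by rewrite -!natrM -natrD ltr_nat.
Qed.

Section cylinder_weights.
Context (R : realType) (Q : measures R).
Let q y := fine (Q (cylinder y)).

Lemma cylinder_fin_num y : Q (cylinder y) \is a fin_num.
Proof. by apply: fin_num_measure; exact: measurable_cylinder. Qed.

Lemma cylinder_weight_ge0 y : 0 <= q y.
Proof. by rewrite fine_ge0. Qed.

Lemma cylinder_weight_nil : q [::] = 1.
Proof.
rewrite /q (_ : cylinder [::] = setT) ?probability_setT //.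
by apply/seteqP; split.
Qed.

Lemma cylinder_weight_split y : q y = q (rcons y false) + q (rcons y true).
Proof.
rewrite /q -fineD ?cylinder_fin_num // -measureU //; try exact: measurable_cylinder.
  congr (fine (Q _)); apply/seteqP; split=> w.
    move=> cy; case E : (w (size y)); [right|left]; apply/cylinder_rcons; by split.
  by case=> /cylinder_rcons[].
apply/seteqP; split => // w /= [/cylinder_rcons[_ h1] /cylinder_rcons[_ h2]].
by rewrite h1 in h2.
Qed.

Lemma cylinder_weight_le1 y : q y <= 1.
Proof.
rewrite -lee_fin fineK ?cylinder_fin_num //.
by apply: probability_le1; exact: measurable_cylinder.
Qed.

End cylinder_weights.

Lemma mass_gt0 N : (0 < mass N)%N.
Proof. by rewrite /mass addn_gt0 expn_gt0. Qed.

(** * Soundness: samples drawn from a measure *)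

Section soundness.
Context (R : realType) (E : nat -> seq (rat * seq bool)) (Q : measures R) (N : nat).
Let q y := fine (Q (cylinder y)).
Hypothesis wsum_le : weight_sum E N q <= 2 ^+ N.

Let K := mass N.
(** The sample repeats each word $x$ of length $N$ about $K q(x)$ times, rounded down, and is then
    cut to exactly $4^N$ entries. Both operations only decrease sums of nonnegative functions, which
    is [sum_L]. *)
Let a x : nat := Num.truncn (K%:R * q x).
Let L0 := flatten [seq nseq (a x) x | x <- words N].
Let L := take (2 ^ (N + N)) L0.

Let Kq_ge0 x : 0 <= K%:R * q x.
Proof. by rewrite mulr_ge0 // cylinder_weight_ge0. Qed.

Let sum_L0 (f : seq bool -> nat) : (\sum_(x <- L0) f x = \sum_(x <- words N) a x * f x)%N.
Proof.
rewrite /L0 big_flatten /= big_map; apply: eq_bigr => x _.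
by rewrite big_nseq iter_addn_0 mulnC.
Qed.

Let sum_L (f : seq bool -> nat) :
  (\sum_(x <- L) f x)%:R <= K%:R * \sum_(x <- words N) (f x)%:R * q x.
Proof.
apply: (@le_trans _ _ (\sum_(x <- L0) f x)%N%:R).
  by rewrite ler_nat -(cat_take_drop (2 ^ (N + N)) L0) big_cat leq_addr.
rewrite sum_L0 natr_sum mulr_sumr; apply: ler_sum => x _.
by rewrite natrM mulrCA mulrC ler_wpM2l // truncn_le.
Qed.

Let sum_q : \sum_(x <- words N) q x = 1.
Proof.
have := sum_words_prefix (cylinder_weight_split Q) (leq0n N : (size [::] <= N)%N).
rewrite -/q cylinder_weight_nil => <-; apply: eq_bigr => x _.
by rewrite prefix0s mul1r.
Qed.

Let size_L : size L = (2 ^ (N + N))%N.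
Proof.
(* Each of the $2^N$ roundings loses at most 1, so [L0] has at least $K-2^N=4^N$ entries. *)
rewrite size_takel // -(leq_add2r (2 ^ N)) -/(mass N) -/K -(ler_nat R).
have -> : size L0 = (\sum_(x <- words N) a x)%N.
  by rewrite -sum1_size sum_L0; apply: eq_bigr => x _; rewrite muln1.
have -> : K%:R = \sum_(x <- words N) K%:R * q x by rewrite -mulr_sumr sum_q mulr1.
rewrite natrD natr_sum -(size_words N).
rewrite -sum1_size natr_sum -big_split /=; apply: ler_sum => x _.
by rewrite natr1 ltW // truncnS_gt.
Qed.

Let L_words : L \in listsn (2 ^ (N + N)) (words N).
Proof.
rewrite mem_listsn size_L eqxx /=; apply/allP => x /mem_take /flatten_mapP[y yw].
by rewrite mem_nseq => /andP[_ /eqP ->].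
Qed.

Let occ_le y : (size y <= N)%N -> (occ y L)%:R <= K%:R * q y.
Proof.
move=> yN; rewrite -[q y](sum_words_prefix (cylinder_weight_split Q) yN).
exact: sum_L.
Qed.

(** The upper estimate [sum_L] applied to the words not extending $y$ gives $4^N-n\le K(1-q(y))$,
    with $n$ the number of words of [L] extending $y$. *)
Let occ_ge y : (size y <= N)%N -> K%:R * q y <= (occ y L + 2 ^ N)%:R.
Proof.
move=> yN.
have := sum_L (fun x => ~~ prefix y x).
have -> : \sum_(x <- words N) (~~ prefix y x)%:R * q x = 1 - q y.
  apply/eqP; rewrite eq_sym subr_eq -[X in _ + X](sum_words_prefix (cylinder_weight_split Q) yN).
  rewrite -/q -big_split /= -[eqbLHS]sum_q; apply/eqP/eq_bigr => x _.
  by case: prefix; rewrite ?mul1r ?mul0r ?addr0 ?add0r.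
have : ((occ y L + \sum_(x <- L) ~~ prefix y x)%N = 2 ^ (N + N))%N.
  by rewrite -size_L -sum1_size -big_split /=; apply: eq_bigr => x _; case: prefix.
move/(congr1 (fun n => n%:R : R)); rewrite natrD => E1 E2.
have : K%:R = (2 ^ (N + N))%:R + (2 ^ N)%:R :> R by rewrite -natrD.
rewrite natrD; move: E1 E2; rewrite mulrBr mulr1; lra.
Qed.

Lemma cover_stage_basic F : cover_stage E F N -> exists2 b, b \in F & basic b Q.
Proof.
move=> /allP /(_ _ L_words) /orP[|/hasP[b bF /allP Hb]].
  (* The first alternative is impossible: the sample sum of [tau] is at most $K$ times the weight
     sum, hence at most $K 2^N$. *)
  rewrite ltnNge => /negP[]; rewrite -(ler_nat R) natrM natrX.
  by apply: le_trans (sum_L _) _; rewrite ler_wpM2l.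
exists b => // -[[y u] v] /Hb /and3P[/= yN Hu Hv].
have K0 : 0 < K%:R :> R by rewrite ltr0n mass_gt0.
rewrite /satisfies /=.
rewrite -[Q _]fineK ?cylinder_fin_num // -/(q y) !lte_fin.
split; rewrite -(ltr_pM2r K0) [q y * _]mulrC.
  by apply: lt_le_trans (occ_le yN); rewrite ratr_lt_nat.
by apply: le_lt_trans (occ_ge yN) _; rewrite nat_lt_ratr.
Qed.

End soundness.

(** * Effective compactness *)

(** Compactness of the segment provides a cluster point, and a cluster point of an ultrafilter is a
    limit. *)
Lemma ultra_cvg_segment (R : realType) (I : Type) (G : set_system I) (f : I -> R) (a b : R) :
  UltraFilter G -> (\forall i \near G, a <= f i <= b) ->
  exists l : R, f i @[i --> G] --> l.
Proof.
move=> UG fab.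
have [] := @segment_compact R a b (f i @[i --> G]) _ _.
  by near=> i; rewrite /= in_itv /=; near: i.
move=> l [_ cl]; exists l => A Al.
have [//|nA] := in_ultra_setVsetC (f @^-1` A) UG.
have [x [/= nAx Ax]] := cl (~` A) A nA Al.
by [].
Unshelve. all: by end_near.
Qed.

Section compactness.
Context (R : realType) (t : Omega -> \bar R) (E : nat -> seq (rat * seq bool)).
Hypothesis t_ge0 : forall w, (0 <= t w)%E.
Hypothesis E_mono : (forall m n, m <= n -> {subset E m <= E n})%N.
Hypothesis tE : forall r : rat, [set w | ((ratr r)%:E < t w)%E] =
  \bigcup_(x in [set x | exists n, (r, x) \in E n]) cylinder x.

(** Additivity, normalisation and the integral bounds all pass to the pointwise limit. They are
    assumed only eventually or in the limit, because sample frequencies are additive at $y$ only for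
    large $N$ and have total mass below 1. *)
Lemma exists_limit_measure (I : Type) (G : set_system I) (p : I -> seq bool -> R) :
  UltraFilter G ->
  (forall y, \forall i \near G, 0 <= p i y <= 1) ->
  (forall y, \forall i \near G, p i y = p i (rcons y false) + p i (rcons y true)) ->
  p i [::] @[i --> G] --> (1 : R) ->
  (forall n, \forall i \near G, weight_sum E n (p i) <= 2 ^+ n) ->
  exists2 Q : measures R, (\int[Q]_w t w <= 1)%E
    & forall y, p i y @[i --> G] --> fine (Q (cylinder y)).
Proof.
move=> UG p01 pD p1 pw.
have /choice[q pq] : forall y, exists l : R, p i y @[i --> G] --> l.
  by move=> y; exact: ultra_cvg_segment (p01 y).
have q0 y : 0 <= q y.
  apply: (closed_cvg _ (@closed_ge R 0) _ _ (pq y)).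
  by near=> i; have /andP[] : 0 <= p i y <= 1 by near: i.
have q1 : q [::] = 1 by exact: cvg_unique (pq [::]) p1.
have qD y : q y = q (rcons y false) + q (rcons y true).
  apply: (cvg_unique _ (pq y)) => //.
  apply: cvg_trans (cvgD (pq (rcons y false)) (pq (rcons y true))).
  apply: near_eq_cvg.
  by near=> i; apply/esym; near: i; exact: pD.
have [Q HQ] := exists_measure_of_weights q0 q1 qD.
exists Q; last by move=> y; rewrite HQ.
apply/(integral_le1P t_ge0 E_mono tE) => n.
apply: (closed_cvg _ (@closed_le R (2 ^+ n)) (pw n)).
rewrite /weight_sum; under eq_bigr do rewrite HQ /=.
apply: cvg_big => [|x _]; first exact: add_continuous.
by apply: cvgM; [exact: cvg_cst|exact: pq].
Unshelve. all: by end_near.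
Qed.

(** Finitely many strict inequalities persist near the limit, even with a vanishing error added. The
    error is 0 for the compactness proof and $2^N/K$ for samples. *)
Lemma near_basic (I : Type) (G : set_system I) (p : I -> seq bool -> R) (e : I -> R)
    (Q : measures R) b :
  Filter G ->
  (forall y, p i y @[i --> G] --> fine (Q (cylinder y))) -> e i @[i --> G] --> (0 : R) ->
  basic b Q -> \forall i \near G, forall c, c \in b ->
    ratr c.1.2 < p i c.1.1 /\ p i c.1.1 + e i < ratr c.2.
Proof.
move=> FG pQ e0; elim: b => [|[[y u] v] b IH] bQ; first by near=> i.
have /IH Gb : basic b Q by move=> c cb; apply: bQ; rewrite inE cb orbT.
have /= := bQ (y, u, v) (mem_head _ _).
rewrite -[Q _]fineK ?cylinder_fin_num // !lte_fin => -[uq qv].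
have pe : p i y + e i @[i --> G] --> fine (Q (cylinder y)).
  by rewrite -[fine _]addr0; exact: cvgD.
near=> i => c; rewrite inE => /predU1P[->|cb] /=.
  split; near: i; first exact: (cvgr_gt _ (pQ y)).
  exact: (cvgr_lt _ pe).
by move: c cb; near: i.
Unshelve. all: by end_near.
Qed.

Let C := [set Q : measures R | (\int[Q]_w t w <= 1)%E].

(** Convergence on every cylinder is convergence in the topology, as a basic neighbourhood is a
    finite set of strict conditions on cylinders. *)
Lemma compact_integral_le1 : compact C.
Proof.
rewrite compact_ultra => G UG GC.
have [||||Q CQ GQ] := @exists_limit_measure _ G (fun Q y => fine (Q (cylinder y))) UG.
- by move=> y; near=> Q; rewrite cylinder_weight_ge0 cylinder_weight_le1.
- by move=> y; near=> Q; exact: cylinder_weight_split.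
- under eq_fun do rewrite cylinder_weight_nil.
  exact: cvg_cst.
- move=> n; apply: filterS GC => Q CQ.
  exact: (integral_le1P t_ge0 E_mono tE Q).1.
exists Q; split => // A; rewrite nbhsE => -[B [oB QB] BA].
have [b bQ bB] : exists2 b, basic b Q & @basic R b `<=` B.
  case: oB QB => D _ <- [b Db bQ]; exists b => // Q' bQ'; by exists b.
suff Gb : G (basic b) by apply: filterS Gb => Q' /bB /BA.
have FG : Filter G by typeclasses eauto.
have e0 : (0 : R) @[_ --> G] --> (0 : R) by exact: cvg_cst.
apply: filterS (near_basic FG GQ e0 bQ) => Q' H [[y u] v] /H /=; rewrite addr0 => -[uq qv].
by rewrite -[Q' _]fineK ?cylinder_fin_num // !lte_fin.
Unshelve. all: by end_near.
Qed.

(** If every stage failed, each [N] would have a sample [L N] with small sum that meets no [b] in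
    [F]. The limit of their frequencies lies in [C], hence in some basic set of [F], and then late
    samples satisfy its conditions after all. *)
Lemma covers_stage F : covers C F -> exists N, cover_stage E F N.
Proof.
move=> CF; apply: contrapT => /forallNP nst.
have /choice[L HL] : forall N, exists L, [/\ size L = (2 ^ (N + N))%N,
    all (fun x => size x == N) L, (\sum_(x <- L) tau E N x <= mass N * 2 ^ N)%N
  & forall b, b \in F -> ~~ all (sample_sat N L) b].
  move=> N; have /negP/allPn[L] := nst N.
  rewrite mem_listsn => /andP[/eqP sL Lw]; rewrite negb_or -leqNgt => /andP[Lt /hasPn Lb].
  exists L; split => //; apply/allP => x /(allP Lw) /=; by rewrite mem_words.
have sL N : size (L N) = (2 ^ (N + N))%N by case: (HL N).
have wL N x : x \in L N -> size x = N.
  by case: (HL N) => _ /allP H _ _ /H /eqP.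
have tL N : (\sum_(x <- L N) tau E N x <= mass N * 2 ^ N)%N by case: (HL N).
have bL N b : b \in F -> ~~ all (sample_sat N (L N)) b.
  by case: (HL N) => _ _ _; apply.
have K0 N : 0 < (mass N)%:R :> R by rewrite ltr0n mass_gt0.
pose p N y : R := (occ y (L N))%:R / (mass N)%:R.
pose e N : R := (2 ^ N)%:R / (mass N)%:R.
have e0 : e N @[N --> \oo] --> (0 : R).
  apply: (@squeeze_cvgr _ _ _ _ (fun=> 0) (@harmonic R)); last 2 first.
  - exact: cvg_cst.
  - exact: cvg_harmonic.
  near=> N; rewrite divr_ge0 //= /e.
  (* Thus $e_N=1/(2^N+1)$, below the harmonic sequence. *)
  have -> : mass N = (2 ^ N * (2 ^ N).+1)%N by rewrite /mass expnD mulnS addnC.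
  rewrite natrM invfM mulrA divff ?mul1r; last by rewrite pnatr_eq0 expn_eq0.
  by rewrite lef_pV2 ?posrE ?ltr0n // ler_nat ltnS ltnW // ltn_expl.
(* [G] refines the filter of cofinite sets, so whatever holds for all large [N] holds near [G]. *)
have [G [UG sG]] := ultraFilterLemma (@eventually_filter).
have Ge0 : e N @[N --> G] --> (0 : R).
  by apply: cvg_trans e0 => A HA; exact: sG.
have occ_le y N : (occ y (L N) <= mass N)%N.
  apply: (@leq_trans (2 ^ (N + N))); last exact: leq_addr.
  by rewrite -sL -sum1_size leq_sum // => x _; exact: leq_b1.
have [||||Q CQ GQ] := @exists_limit_measure _ G p UG.
- move=> y; near=> N; rewrite divr_ge0 //= /p ler_pdivrMr // mul1r ler_nat.
  exact: occ_le.
- move=> y; apply: sG; exists (size y).+1 => // N /= yN.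
  rewrite /p -mulrDl -natrD /occ -big_split /= big_seq [in RHS]big_seq.
  congr (_%:R / _); apply: eq_bigr => x /wL sx.
  by apply: prefix_split; rewrite sx.
(* A sample has $4^N=K-2^N$ entries, so its total frequency is $1-e_N$. *)
- have -> : (fun N => p N [::]) = (fun N => 1 - e N).
    apply/funext => N; apply: (mulIf (lt0r_neq0 (K0 N))).
    rewrite mulrBl mul1r !divfK ?lt0r_neq0 //.
    have -> : occ [::] (L N) = (2 ^ (N + N))%N.
      by rewrite -sL -sum1_size; apply: eq_bigr => x _; rewrite prefix0s.
    by rewrite /mass natrD addrK.
  rewrite -[X in _ --> X]subr0; apply: cvgB => //; exact: cvg_cst.
- move=> n; apply: sG; exists n => // N /= nN.
  rewrite /weight_sum /p.
  (* Grouping the entries of the sample by their first [n] bits turns the weighted sum over words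
     into a sum over the sample. *)
  have -> : \sum_(x <- words n) (tau E n x)%:R * ((occ x (L N))%:R / (mass N)%:R) =
    (\sum_(x <- L N) tau E n (take n x))%N%:R / (mass N)%:R :> R.
    under [LHS]eq_bigr do rewrite mulrA -natrM.
    rewrite -mulr_suml -natr_sum; congr (_%:R / _).
    under [LHS]eq_bigr do rewrite /occ big_distrr /=.
    rewrite exchange_big /= big_seq [RHS]big_seq; apply: eq_bigr => x /wL sx.
    have st : size (take n x) = n by rewrite size_takel ?sx.
    rewrite (bigD1_seq (take n x)) ?uniq_words ?mem_words ?st //=.
    rewrite -{3}(cat_take_drop n x) prefix_prefix muln1 big_seq_cond big1 ?addn0 //.
    move=> z; rewrite mem_words => /andP[/eqP sz zx].
    by rewrite prefixE sz eq_sym (negbTE zx) muln0.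
  rewrite ler_pdivrMr // -natrX -natrM ler_nat mulnC.
  (* Scaling by $2^{N-n}$ lets [tau_mono] compare the sum at level [n] with the bound [tL] on
     [tau E N]. *)
  rewrite -(leq_pmul2r (_ : 0 < 2 ^ (N - n))%N) ?expn_gt0 //.
  rewrite -mulnA -expnD subnKC // big_distrl /=.
  apply: leq_trans (tL N); apply: leq_sum => x _; exact: tau_mono.
have [b bF bQ] := CF _ CQ.
have FG : Filter G by typeclasses eauto.
have [N HN] := filter_ex (filterI (near_basic FG GQ Ge0 bQ)
  (sG _ (nbhs_infty_ge (\max_(c <- b) size c.1.1)))).
move: HN => [HN /= Nb].
have /negP := bL N b bF; apply; apply/allP => -[[y u] v] cb.
have [/= uq qv] := HN _ cb; apply/and3P => /=; split.
- by apply: leq_trans Nb; exact: (leq_bigmax_seq (F := fun c : condition => size c.1.1) _ cb isT).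
- by rewrite -(ratr_lt_nat R) -ltr_pdivlMr.
- by rewrite -(nat_lt_ratr R) -ltr_pdivrMr // natrD mulrDl.
Unshelve. all: by end_near.
Qed.

End compactness.

Lemma effectively_compact_integral_le1 (R : realType) (t : Omega -> \bar R) :
  lower_semicomputable t ->
  effectively_compact [set Q : measures R | (\int[Q]_w t w <= 1)%E].
Proof.
move=> [t0 [W /enumerable_stages[E [cE Emono WE]] tW]].
have tE r : [set w | ((ratr r)%:E < t w)%E] =
    \bigcup_(x in [set x | exists n, (r, x) \in E n]) cylinder x.
  rewrite tW; congr (\bigcup_(x in _) _); apply/seteqP.
  by split=> x /WE.
split; first exact: (compact_integral_le1 t0 Emono tE).
apply: (@enumerable_of_stages _ _ (cover_stage E)).
- do 2!apply: tsurj_seq; apply: tsurj_prod; last exact: tsurj_rat.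
  by apply: tsurj_prod; [apply/tsurj_seq/tsurj_bool|exact: tsurj_rat].
- exact: tcomp_cover_stage.
move=> F; split; first exact: (covers_stage t0 Emono tE).
move=> [N st] Q CQ.
have [b bF bQ] := cover_stage_basic ((integral_le1P t0 Emono tE Q).1 CQ N) st.
by exists b.
Qed.

Theorem theorem19 (R : realType) (P : measures R) (w : Omega) :
  blindly_random P w <->
  (forall C : set (measures R), effectively_compact C -> C P -> class_random C w).
Proof.
split=> [Pw C _ CP t [lt /(_ _ CP) tP]|H t [lt tP]]; first exact: Pw.
by apply: (H _ (effectively_compact_integral_le1 lt)) => //; split.
Qed.
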